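(* Let $\mathcal A:H_1\to H_2$ be a Hilbert--Schmidt operator of rank at least $k+p+2$. For $m,n\in\mathbb N$ let $W_n=[w_1,\dots,w_n]$ and $Z_m=[z_1,\dots,z_m]$ be quasi-matrices with orthonormal columns in $H_1$ and $H_2$, respectively, let $A_{m,n}=Z_m^*\mathcal AW_n\in\mathbb R^{m\times n}$ and $\mathcal A_{m,n}=Z_mA_{m,n}W_n^*$, and suppose that $\|\mathcal A-\mathcal A_{m,n}\|_{\mathrm{HS}}\to0$ as $m,n\to\infty$. Let $\mu=\mathcal N_{H_2}(0,\mathcal A\mathcal A^* )$ and $\mu_n=\mathcal N_{H_2}(0,\mathcal AW_nW_n^*\mathcal A^* )$, and let $\Gamma(\mu_n,\mu)$ be the set of all Borel probability measures on $H_2\times H_2$ with marginals $\mu_n$ and $\mu$. Let $\widehat{\mathcal A}$ and $\widehat{\mathcal A}_{m,n}$ be the approximations produced by applying the randomized SVD with $k+p$ samples to $\mathcal A$ and to its discretization $A_{m,n}$, respectively, i.e. $$\widehat{\mathcal A}=P_Y\mathcal A,\qquad \widehat{\mathcal A}_{m,n}=P_{Z_mZ_m^*Y_n}\,\mathcal A\,W_nW_n^*,$$ where $Y=[y_1,\dots,y_{k+p}]$, $Y_n=[y_{n,1},\dots,y_{n,k+p}]$. Then there is a constant $C$ independent of $m,n$ such that $$\inf_{\gamma\in\Gamma(\mu_n,\mu)}\mathbb E\|\widehat{\mathcal A}-\widehat{\mathcal A}_{m,n}\|_{\mathrm{HS}}\le C\,\|\mathcal A-\mathcal A_{m,n}\|_{\mathrm{HS}},$$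 where the expectation is taken with respect to $\gamma^{\otimes(k+p)}$, the joint distribution of the $k+p$ independent column pairs $(y_{n,j},y_j)\sim\gamma$. In particular, $$\lim_{m,n\to\infty}\Big[\inf_{\gamma\in\Gamma(\mu_n,\mu)}\mathbb E\|\widehat{\mathcal A}-\widehat{\mathcal A}_{m,n}\|_{\mathrm{HS}}\Big]=0.$$
   Context: $H_1,H_2$ are real, separable, infinite-dimensional Hilbert spaces; $k\ge1$, $p\ge0$ are integers. $\|\cdot\|_{\mathrm{HS}}$ is the Hilbert--Schmidt norm. $\mathcal N_H(0,\mathcal T)$ is the centered Gaussian measure on $H$ with self-adjoint positive semi-definite trace-class covariance operator $\mathcal T$. A quasi-matrix $F=[f_1,\dots,f_r]$ with columns $f_i$ in a Hilbert space $H$ is identified with the operator $\mathbb R^r\to H$, $\xi\mapsto\sum_i\xi_if_i$, with adjoint $F^*f=(\langle f_i,f\rangle_H)_{i=1}^r$. For a quasi-matrix $X$, $P_X$ denotes the orthogonal projector onto $\mathrm{range}(X)$; $Z_mZ_m^*Y_n$ is the quasi-matrix with columns $Z_mZ_m^*y_{n,j}$. The infinite-dimensional randomized SVD of $\mathcal A$ with $k+p$ samples draws $Y$ with i.i.d. columns $y_j\sim\mu$ and returns $\widehat{\mathcal A}=QQ^*\mathcal A$, with $Q$ an orthonormal basis of $\mathrm{range}(Y)$, so $QQ^*=P_Y$. The randomized SVD of $A_{m,n}$ with $k+p$ samples takes a matrix $\Omega_n'\in\mathbb R^{n\times(k+p)}$ with i.i.d. $\mathcal N(0,1)$ entries, an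 orthonormal basis $Q_m$ of $\mathrm{range}(A_{m,n}\Omega_n')$, and yields $\widehat{\mathcal A}_{m,n}=Z_mQ_mQ_m^*A_{m,n}W_n^*$. With $Y_n=\mathcal AW_n\Omega_n'$, whose columns are i.i.d. with distribution $\mu_n$, this equals $P_{Z_mZ_m^*Y_n}\mathcal AW_nW_n^*$. *)

(* Defs.v *)
From HB Require Import structures.
From mathcomp Require Import all_boot all_order all_algebra.
From mathcomp Require Import sesquilinear.
From mathcomp Require Import all_classical all_reals all_analysis.
Import Order.TTheory GRing.Theory Num.Theory.
Import numFieldNormedType.Exports.

Set Implicit Arguments.
Unset Strict Implicit.
Unset Printing Implicit Defensive.

Local Open Scope classical_set_scope.
Local Open Scope ring_scope.

HB.mixin Record NormedModule_isPreHilbert (R : realType) T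
    & NormedModule R T := {
  inner : {dot T for (@idfun R)} ;
  inner_normE : forall x : T, inner x x = `|x| ^+ 2
}.

#[short(type="hilbertType")]
HB.structure Definition Hilbert (R : realType) :=
  {T of CompleteNormedModule R T & NormedModule_isPreHilbert R T}.

Section hilbert_spaces.
Context {R : realType}.
Implicit Types H : hilbertType R.

Definition separable H := exists2 D : set H, countable D & dense D.

Definition lin_indep H (r : nat) (x : 'I_r -> H) :=
  forall c : 'I_r -> R, \sum_i c i *: x i = 0 -> forall i, c i = 0.

Definition infinite_dim H := forall r, exists x : 'I_r -> H, lin_indep x.

Definition rank_ge H1 H2 (A : H1 -> H2) (r : nat) :=
  exists y : 'I_r -> H2, (forall i, range A (y i)) /\ lin_indep y.

Definition orthonormal_family H (I : eqType) (e : I -> H) :=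
  forall i j, inner (e i) (e j) = (i == j)%:R.

Definition orthonormal_basis H (e : nat -> H) :=
  orthonormal_family e /\
  dense [set x : H | exists n (c : 'I_n -> R), x = \sum_(i < n) c i *: e i].

(* Some orthonormal basis; one exists as soon as [H] is separable and
   infinite-dimensional, and the value is meaningless otherwise. *)
Definition onb H : nat -> H := xget (fun=> 0) (@orthonormal_basis H).

(* For continuous linear [A] the value, possibly [+oo], does not depend on the
   orthonormal basis. *)
Definition hs_norm H1 H2 (A : H1 -> H2) : \bar R :=
  sqrte (\sum_(0 <= i <oo) (`|A (onb H1 i)| ^+ 2)%:E)%E.

Definition hilbert_schmidt H1 H2 (A : {linear H1 -> H2}) :=
  continuous A /\ (hs_norm A < +oo)%E.

(* Well defined (Riesz) for continuous linear [A]. *)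
Definition adjoint H1 H2 (A : H1 -> H2) (y : H2) : H1 :=
  xget 0 [set z | forall x, inner (A x) y = inner x z].

(* Well defined when [S] is a closed subspace. *)
Definition orthoproj H (S : set H) (x : H) : H :=
  xget 0 [set y | S y /\ forall z, S z -> inner (x - y) z = 0].

End hilbert_spaces.

Section quasimatrices.
Context {R : realType}.
Implicit Types H : hilbertType R.

Definition quasimatrix H (r : nat) := 'I_r -> H.

Definition qm_op H r (F : quasimatrix H r) (xi : 'cV[R]_r) : H :=
  \sum_i xi i 0 *: F i.

Definition qm_adj H r (F : quasimatrix H r) (f : H) : 'cV[R]_r :=
  \col_i inner f (F i).

(* [F F^*] *)
Definition qm_outer H r (F : quasimatrix H r) (f : H) : H :=
  qm_op F (qm_adj F f).

Definition qm_proj H r (F : quasimatrix H r) : H -> H :=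
  orthoproj (range (qm_op F)).

Variables (H1 H2 : hilbertType R) (A : H1 -> H2).

(* [Z^* A W] *)
Definition discr_mx m n (Z : quasimatrix H2 m) (W : quasimatrix H1 n)
  : 'M[R]_(m, n) := \matrix_(i, j) inner (A (W j)) (Z i).

Definition discr_op m n (Z : quasimatrix H2 m) (W : quasimatrix H1 n)
    (x : H1) : H2 :=
  qm_op Z (discr_mx Z W *m qm_adj W x).

(* [P_Y A] *)
Definition rsvd r (Y : quasimatrix H2 r) (x : H1) : H2 := qm_proj Y (A x).

(* [P_{Z Z^* Y} A W W^*] *)
Definition rsvd_discr m n r (Z : quasimatrix H2 m) (W : quasimatrix H1 n)
    (Y : quasimatrix H2 r) (x : H1) : H2 :=
  qm_proj (qm_outer Z \o Y) (A (qm_outer W x)).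

End quasimatrices.

Definition borel (T : topologicalType) := g_sigma_algebraType (@open T).

Section gaussian.
Context {R : realType}.

(* The case distinction is needed: the library's [normal_prob m 0] is not the
   Dirac measure at [m]. *)
Definition centered_normal (variance : R) : set R -> \bar R :=
  if variance == 0 then \d_(0 : R) else normal_prob 0 (Num.sqrt variance).

(* [mu] is the centered Gaussian measure with covariance operator [T]: under
   [mu], every [inner h] has law N(0, <T h, h>). This determines [mu] when [H]
   is separable. *)
Definition gaussian (H : hilbertType R) (mu : probability (borel H) R)
    (T : H -> H) :=
  forall (h : H) (B : set R), measurable B ->
    mu (inner h @^-1` B) = centered_normal (inner (T h) h) B.

Definition couplings (H : hilbertType R) (mu nu : probability (borel H) R)
  : set (probability (borel (H * H)%type) R) :=
  [set gamma | forall B : set (borel H), measurable B ->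
     gamma (@fst H H @^-1` B) = mu B /\ gamma (@snd H H @^-1` B) = nu B].

End gaussian.

Section power_measure.
Context d (T : measurableType d) (R : realType) (P : probability T R).

Definition tuple_cons n (x : T * n.-tuple T) : n.+1.-tuple T :=
  [tuple of x.1 :: x.2].

Lemma measurable_tuple_cons n :
  measurable_fun [set: T * n.-tuple T] (@tuple_cons n).
Proof. exact: measurable_cons. Qed.

HB.instance Definition _ n :=
  isMeasurableFun.Build _ _ _ _ (@tuple_cons n) (@measurable_tuple_cons n).

(* The [n]-fold product measure, on the product sigma-algebra of
   [n.-tuple T]. *)
Fixpoint power_prob n : probability (n.-tuple T) R :=
  if n is m.+1 then distribution (P \x power_prob m)%E (@tuple_cons m)
  else \d_[tuple].

End power_measure.

Section rsvd_error.
Context {R : realType} (H1 H2 : hilbertType R) (A : H1 -> H2).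

Definition discr_error m n (Z : quasimatrix H2 m) (W : quasimatrix H1 n)
  : \bar R := hs_norm (fun x => A x - discr_op A Z W x).

Definition expected_rsvd_error m n (Z : quasimatrix H2 m)
    (W : quasimatrix H1 n) (r : nat)
    (gamma : probability (borel (H2 * H2)%type) R) : \bar R :=
  (\int[power_prob gamma r]_om
     let Yn : quasimatrix H2 r := fun j => (tnth om j : H2 * H2).1 in
     let Y : quasimatrix H2 r := fun j => (tnth om j : H2 * H2).2 in
     hs_norm (fun x => (rsvd A Y x - rsvd_discr A Z W Yn x)%R))%E.

Definition best_rsvd_error m n (Z : quasimatrix H2 m)
    (W : quasimatrix H1 n) (r : nat) (mu_n mu : probability (borel H2) R)
  : \bar R :=
  ereal_inf [set expected_rsvd_error Z W r gamma |
              gamma in couplings mu_n mu].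

End rsvd_error.

(* Main.v *)
(* Let P_Y and P_X be the projectors onto the ranges of Y and X = Z Z^* Y_n. If
   |Y c| >= t |c_j| for all c and j, then |P_Y - P_X| is at most a constant times
   (sum_j |y_j - x_j|) / t, so that, by the inequality a / t <= (a^2 / D + D / t^2) / 2,
   it suffices to find a coupling with E |y - Z Z^* y_n|^2 <= 8 D^2 for each D greater
   than the discretization error, and to bound E t^-2.

   Coupling. Formally y = A g and y_n = A W W^* g for the same white noise g. Only
   finitely many coordinates of g matter: those along the range of A^* are, up to a
   small error, linear functionals of y, and the others are independent normal
   variables. The infimum over couplings absorbs the error. The laws are identified
   with mu and mu_n because a Borel measure on a separable Hilbert space is determined
   by its one-dimensional marginals.

   Inverse moment. As rank A >= k + p + 2, three directions orthogonal to all samples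
   but y_j carry independent standard normal coordinates of y_j. Hence the distance
   of y_j to the span of the other samples is less than t with probability O(t^3),
   which makes E t^-2 finite. *)

(* The lower bound |Y c| >= t |c_j| is asked of Y alone. The columns of Z Z^* Y_n may well be
   dependent, for instance when m or n is small, so no inverse moment of theirs could be uniform.
   The law of Y involves neither m nor n, and therefore neither does the constant. The range of A^*
   need not be closed, so it can only be arranged that the part of w_j left over is nearly
   orthogonal to it. The gap between D^2 and the squared discretization error is the room for this
   defect. The best error does not depend on D, and D may decrease to the discretization error at
   the end. The power 3 is what the dyadic estimate needs: E t^-2 is dominated by a series of 4^k
   times the probability of a distance below 2^-k, which converges when that probability is O(8^-k),
   while O(4^-k) would not suffice. The error is never shown to be a measurable function of the
   samples. It is compared pointwise with a measurable majorant. *)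
Require Import Defs.
From HB Require Import structures.
From mathcomp Require Import all_boot all_order all_algebra.
From mathcomp Require Import sesquilinear.
From mathcomp Require Import all_classical all_reals all_analysis.
From mathcomp Require Import measurable_realfun ring lra.
Import Order.TTheory GRing.Theory Num.Theory.
Import numFieldNormedType.Exports.

Set Implicit Arguments.
Unset Strict Implicit.
Unset Printing Implicit Defensive.

Local Open Scope classical_set_scope.
Local Open Scope ring_scope.

(** * Orthonormal sequences in a Hilbert space *)

Section inner_product.
Context {R : realType} (H : hilbertType R).
Implicit Types (x y z u v : H) (q s : seq H) (a b : R).
Local Notation "<[ x , y ]>" := (inner x y).

Lemma innerC x y : <[x, y]> = <[y, x]>.
Proof. by have := hermC (@inner R H) x y; rewrite /= expr0 mul1r. Qed.

Lemma innerDl x y z : <[x + y, z]> = <[x, z]> + <[y, z]>.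
Proof. exact: linearDl. Qed.

Lemma innerDr x y z : <[z, x + y]> = <[z, x]> + <[z, y]>.
Proof. exact: linearDr. Qed.

Lemma innerZl a x z : <[a *: x, z]> = a * <[x, z]>.
Proof. exact: linearZl_LR. Qed.

Lemma innerZr a x z : <[z, a *: x]> = a * <[z, x]>.
Proof. by rewrite innerC innerZl innerC. Qed.

Lemma innerNl x z : <[- x, z]> = - <[x, z]>.
Proof. by rewrite -scaleN1r innerZl mulN1r. Qed.

Lemma innerNr x z : <[z, - x]> = - <[z, x]>.
Proof. by rewrite innerC innerNl innerC. Qed.

Lemma innerBl x y z : <[x - y, z]> = <[x, z]> - <[y, z]>.
Proof. by rewrite innerDl innerNl. Qed.

Lemma innerBr x y z : <[z, x - y]> = <[z, x]> - <[z, y]>.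
Proof. by rewrite innerDr innerNr. Qed.

Lemma inner0l z : <[0, z]> = 0.
Proof. by rewrite -(scale0r z) innerZl mul0r. Qed.

Lemma inner0r z : <[z, 0]> = 0.
Proof. by rewrite innerC inner0l. Qed.

Lemma inner_suml I (r : seq I) (P : pred I) (F : I -> H) z :
  <[\sum_(i <- r | P i) F i, z]> = \sum_(i <- r | P i) <[F i, z]>.
Proof. exact: (big_morph (fun x => <[x, z]>) (fun x y => innerDl x y z) (inner0l z)). Qed.

Lemma inner_sumr I (r : seq I) (P : pred I) (F : I -> H) z :
  <[z, \sum_(i <- r | P i) F i]> = \sum_(i <- r | P i) <[z, F i]>.
Proof. exact: (big_morph (fun x => <[z, x]>) (fun x y => innerDr x y z) (inner0r z)). Qed.

Lemma inner_ge0 x : 0 <= <[x, x]>.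
Proof. by rewrite inner_normE sqr_ge0. Qed.

Lemma normD_sqr x y : `|x + y| ^+ 2 = `|x| ^+ 2 + 2 * <[x, y]> + `|y| ^+ 2.
Proof. by rewrite -!inner_normE !innerDl !innerDr (innerC y x); ring. Qed.

Lemma normB_sqr x y : `|x - y| ^+ 2 = `|x| ^+ 2 - 2 * <[x, y]> + `|y| ^+ 2.
Proof. by rewrite normD_sqr innerNr normrN mulrN. Qed.

Lemma cauchy_schwarz x y : `|<[x, y]>| <= `|x| * `|y|.
Proof.
have [->|y0] := eqVneq y 0; first by rewrite inner0r normr0 mulr_ge0.
rewrite -ler_sqr ?nnegrE ?mulr_ge0// real_normK ?num_real// exprMn.
have ny : 0 < `|y| ^+ 2 by rewrite exprn_gt0 ?normr_gt0.
have := inner_ge0 (x - (<[x, y]> / `|y| ^+ 2) *: y).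
rewrite inner_normE normB_sqr innerZr normrZ exprMn real_normK ?num_real//.
set c := <[x, y]> => h.
have : 0 <= (`|x| ^+ 2 - 2 * (c / `|y| ^+ 2 * c) + (c / `|y| ^+ 2) ^+ 2 * `|y| ^+ 2) * `|y| ^+ 2.
  by rewrite mulr_ge0// ltW.
rewrite (_ : _ * _ = `|x| ^+ 2 * `|y| ^+ 2 - c ^+ 2) ?subr_ge0//.
by field; rewrite normr_eq0.
Qed.

Lemma inner_le x y : <[x, y]> <= `|x| * `|y|.
Proof. exact: le_trans (ler_norm _) (cauchy_schwarz _ _). Qed.

Lemma inner_all0 x : (forall y, <[x, y]> = 0) -> x = 0.
Proof. by move=> /(_ x); rewrite inner_normE => /eqP; rewrite sqrf_eq0 normr_eq0 => /eqP. Qed.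

Lemma inner_allE x x' : (forall y, <[x, y]> = <[x', y]>) -> x = x'.
Proof. by move=> h; apply/subr0_eq/inner_all0 => y; rewrite innerBl h subrr. Qed.

Lemma continuous_inner h : continuous (inner h : H -> R).
Proof.
move=> x; apply/cvgrPdist_lt => e e0.
have h0 : 0 < e / (`|h| + 1) by rewrite divr_gt0// ltr_wpDl.
near=> y.
rewrite -innerBr (le_lt_trans (cauchy_schwarz _ _))//.
have hy : `|x - y| < e / (`|h| + 1) by near: y; exact: cvgr_dist_lt.
rewrite (@le_lt_trans _ _ ((`|h| + 1) * `|x - y|)) ?ler_wpM2r ?lerDl//.
by rewrite mulrC -ltr_pdivlMr// ltr_wpDl.
Unshelve. all: by end_near. Qed.

(** Lists rather than indexed families: Gram--Schmidt grows them at the head, and the coupling works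
    with a concatenation [f ++ q] whose two halves play different roles. *)
Fixpoint oseq q : Prop :=
  if q is e :: q' then [/\ `|e| = 1, (forall x, x \in q' -> <[e, x]> = 0) & oseq q']
  else True.

Definition oproj q x : H := \sum_(e <- q) <[x, e]> *: e.

Lemma oprojD q x y : oproj q (x + y) = oproj q x + oproj q y.
Proof. by rewrite -big_split; apply: eq_bigr => e _; rewrite innerDl scalerDl. Qed.

Lemma oprojZ q a x : oproj q (a *: x) = a *: oproj q x.
Proof. by rewrite scaler_sumr; apply: eq_bigr => e _; rewrite innerZl scalerA. Qed.

Lemma oprojN q x : oproj q (- x) = - oproj q x.
Proof. by rewrite -scaleN1r oprojZ scaleN1r. Qed.

Lemma oprojB q x y : oproj q (x - y) = oproj q x - oproj q y.
Proof. by rewrite oprojD oprojN. Qed.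

Lemma oproj0 q : oproj q 0 = 0.
Proof. by have := oprojZ q 0 0; rewrite !scale0r. Qed.

Lemma oproj_sum q I (r : seq I) (P : pred I) (F : I -> H) :
  oproj q (\sum_(i <- r | P i) F i) = \sum_(i <- r | P i) oproj q (F i).
Proof. exact: (big_morph (oproj q) (oprojD q) (oproj0 q)). Qed.

Lemma inner_oproj q x y : <[oproj q x, y]> = \sum_(e <- q) <[x, e]> * <[y, e]>.
Proof. by rewrite inner_suml; apply: eq_bigr => e _; rewrite innerZl (innerC e). Qed.

Lemma oproj_sym q x y : <[oproj q x, y]> = <[x, oproj q y]>.
Proof. by rewrite (innerC x) !inner_oproj; apply: eq_bigr => e _; rewrite mulrC. Qed.

Lemma oproj_mem q e : oseq q -> e \in q -> oproj q e = e.
Proof.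
elim: q => // f q IH /= [f1 fq oq]; rewrite inE /oproj big_cons => /orP[/eqP->|eq].
  rewrite inner_normE f1 expr1n scale1r big_seq big1 ?addr0// => g gq.
  by rewrite fq// scale0r.
by rewrite innerC fq// scale0r add0r; exact: IH.
Qed.

Lemma oproj_idem q x : oseq q -> oproj q (oproj q x) = oproj q x.
Proof.
move=> oq; rewrite {2}/oproj oproj_sum; rewrite [in LHS]big_seq [in RHS]/oproj [in RHS]big_seq.
by apply: eq_bigr => e eq; rewrite oprojZ (oproj_mem oq).
Qed.

Lemma oproj_orth q x y : oseq q -> <[x - oproj q x, oproj q y]> = 0.
Proof. by move=> oq; rewrite -oproj_sym oprojB (oproj_idem _ oq) subrr inner0l. Qed.

Lemma norm_oproj_sqr q x : oseq q -> `|oproj q x| ^+ 2 = \sum_(e <- q) <[x, e]> ^+ 2.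
Proof.
move=> oq; rewrite -inner_normE -oproj_sym (oproj_idem _ oq) inner_oproj.
by apply: eq_bigr => e _; rewrite expr2.
Qed.

Lemma pythagoras q x : oseq q ->
  `|x| ^+ 2 = `|oproj q x| ^+ 2 + `|x - oproj q x| ^+ 2.
Proof.
move=> oq; have := normD_sqr (x - oproj q x) (oproj q x).
by rewrite subrK (oproj_orth _ _ oq) mulr0 addr0 addrC.
Qed.

Lemma norm_oproj_le q x : oseq q -> `|oproj q x| <= `|x|.
Proof.
move=> oq; rewrite -ler_sqr ?nnegrE// (pythagoras x oq) lerDl.
exact: sqr_ge0.
Qed.

Lemma norm_residual_le q x : oseq q -> `|x - oproj q x| <= `|x|.
Proof.
move=> oq; rewrite -ler_sqr ?nnegrE// (pythagoras x oq) lerDr.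
exact: sqr_ge0.
Qed.

(** Subtracting from [x] a vector fixed by the projector does not change the residual. *)
Lemma best_approx q x y : oseq q -> oproj q y = y ->
  `|x - oproj q x| <= `|x - y|.
Proof.
move=> oq yE; have -> : x - oproj q x = (x - y) - oproj q (x - y).
  by rewrite oprojB yE opprB addrA subrK.
exact: norm_residual_le.
Qed.

Lemma oseq_residual q x : oseq q -> x <> oproj q x ->
  exists2 f, oseq (f :: q) & exists2 a, a != 0 & f = a *: (x - oproj q x).
Proof.
move=> oq xq; set z := x - oproj q x.
have z0 : `|z| != 0 by rewrite normr_eq0; apply/eqP => /subr0_eq.
exists (`|z|^-1 *: z); last by exists (`|z|^-1); rewrite ?invr_neq0.
split => //; first by rewrite normrZ normfV normr_id mulVf.
by move=> e eq; rewrite innerZl -(oproj_mem oq eq) (oproj_orth _ _ oq) mulr0.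
Qed.

Lemma oproj_cons f q x : oproj (f :: q) x = <[x, f]> *: f + oproj q x.
Proof. by rewrite /oproj big_cons. Qed.

Lemma oproj_cat s q x : oproj (s ++ q) x = oproj s x + oproj q x.
Proof. by rewrite /oproj big_cat. Qed.

Lemma oseq_catr s q : oseq (s ++ q) -> oseq q.
Proof. by elim: s => //= f s IH [_ _ /IH]. Qed.

Lemma oseq_inner_cat s q x y : oseq (s ++ q) -> x \in s -> y \in q -> <[x, y]> = 0.
Proof.
elim: s => //= f s IH [_ fq oq]; rewrite inE => /orP[/eqP-> yq|xs yq]; last exact: IH.
by apply: fq; rewrite mem_cat yq orbT.
Qed.

Lemma oproj_catr s q x : oseq (s ++ q) -> oproj q x = x -> oproj (s ++ q) x = x.
Proof.
move=> o xE; rewrite oproj_cat xE /oproj big_seq big1 ?add0r// => e es.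
rewrite -xE oproj_sym /oproj big_seq big1 ?inner0r ?scale0r// => g gq.
by rewrite (oseq_inner_cat o es gq) scale0r.
Qed.

Lemma oseq_residual_span q x f a : oseq (f :: q) -> a != 0 ->
  f = a *: (x - oproj q x) -> oproj (f :: q) x = x.
Proof.
move=> o a0 fE; have oq : oseq q by case: o.
have xE : x = a^-1 *: f + oproj q x by rewrite fE scalerA mulVf// scale1r subrK.
rewrite {1}xE oprojD oprojZ (oproj_mem o) ?mem_head//.
by rewrite (@oproj_catr [:: f]) ?oproj_idem//; rewrite -xE.
Qed.

Lemma oproj_in (S : set H) q x : (forall a x y, S x -> S y -> S (a *: x + y)) -> S 0 ->
  (forall e, e \in q -> S e) -> S (oproj q x).
Proof.
move=> Slin S0; elim: q => [|e q IH] Sq; first by rewrite /oproj big_nil.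
rewrite oproj_cons; apply: Slin; first by apply: Sq; rewrite mem_head.
by apply: IH => y yq; apply: Sq; rewrite inE yq orbT.
Qed.

(** Gram--Schmidt that never leaves the subspace [S], which need not be closed. Its main use is with
    the range of the adjoint, where every vector found must keep a preimage. *)
Lemma oseq_extend_in (S : set H) q s :
  (forall a x y, S x -> S y -> S (a *: x + y)) -> S 0 ->
  (forall x, x \in q -> S x) -> (forall x, x \in s -> S x) -> oseq q ->
  exists f, [/\ oseq (f ++ q), (forall x, x \in s -> oproj (f ++ q) x = x) &
                forall x, x \in f -> S x].
Proof.
move=> Slin S0 Sq Ss oq; elim: s Ss => [|x s IH] Ss; first by exists [::].
have [|f [of_ fs Sf]] := IH; first by move=> y ys; apply: Ss; rewrite inE ys orbT.
have [xE|xE] := EM (x = oproj (f ++ q) x).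
  by exists f; split => // y; rewrite inE => /orP[/eqP->//|]; exact: fs.
have [g og [a a0 gE]] := oseq_residual of_ xE.
have Sfq y : y \in f ++ q -> S y by rewrite mem_cat => /orP[/Sf|/Sq].
exists (g :: f); split => // [y|y]; rewrite inE => /orP[/eqP->|]; last 1 first.
- exact: Sf.
- exact: oseq_residual_span og a0 gE.
- by move=> ys; apply: (@oproj_catr [:: g]) => //; exact: fs.
rewrite gE -[_ *: _]addr0; apply: (Slin) => //.
rewrite addrC -scaleN1r; apply: (Slin); first exact: oproj_in.
by apply: Ss; rewrite mem_head.
Qed.

Lemma oseq_extend q s : oseq q ->
  exists2 f, oseq (f ++ q) & forall x, x \in s -> oproj (f ++ q) x = x.
Proof.
by move=> oq; have [//|//|//|//|f [? ? _]] := @oseq_extend_in setT q s _ _ _ _ oq; exists f.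
Qed.

Lemma oseq_map (I : eqType) (e : I -> H) (r : seq I) : uniq r ->
  (forall i j, i \in r -> j \in r -> <[e i, e j]> = (i == j)%:R) -> oseq (map e r).
Proof.
elim: r => //= i r IH /andP[ir ur] on; split.
- have := on i i (mem_head _ _) (mem_head _ _); rewrite inner_normE eqxx => /eqP.
  by rewrite sqrp_eq1// => /eqP.
- move=> _ /mapP[j jr ->]; rewrite on ?mem_head ?inE ?jr ?orbT//.
  by case: eqP ir => // ->; rewrite jr.
- by apply: IH => // j j' jr j'r; apply: on; rewrite inE ?jr ?j'r orbT.
Qed.

Lemma oseq_nth q : oseq q -> forall i j : 'I_(size q),
  <[q`_i, q`_j]> = (i == j)%:R.
Proof.
elim: q => [_ []//|e q IH] /= [e1 eq oq] [i ilt] [j jlt].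
have sub k : (k < size q)%N -> q`_k \in q by move=> ?; rewrite mem_nth.
case: i ilt => [|i] ilt; case: j jlt => [|j] jlt /=.
- by rewrite inner_normE e1 expr1n.
- by rewrite eq// sub.
- by rewrite innerC eq// sub.
- exact: (IH oq (Ordinal (ilt : (i < size q)%N)) (Ordinal (jlt : (j < size q)%N))).
Qed.

Lemma oseq_family n (W : quasimatrix H n) : orthonormal_family W ->
  oseq (map W (index_enum 'I_n)).
Proof. by move=> oW; apply: oseq_map => [|i j _ _]; rewrite ?index_enum_uniq. Qed.

Lemma qm_outerE n (W : quasimatrix H n) x :
  qm_outer W x = oproj (map W (index_enum 'I_n)) x.
Proof. by rewrite /oproj big_map; apply: eq_bigr => i _; rewrite mxE. Qed.

Lemma qm_outer_sym n (W : quasimatrix H n) x y : <[qm_outer W x, y]> = <[x, qm_outer W y]>.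
Proof. by rewrite !qm_outerE oproj_sym. Qed.

Lemma norm_orthonormal_sum (I : eqType) (w : I -> H) (c : I -> R) (r : seq I) :
  uniq r -> orthonormal_family w ->
  `|\sum_(i <- r) c i *: w i| ^+ 2 = \sum_(i <- r) c i ^+ 2.
Proof.
move=> ur ow; rewrite -inner_normE inner_suml big_seq [RHS]big_seq; apply: eq_bigr => i ir.
rewrite innerZl inner_sumr (bigD1_seq i)//= innerZr ow eqxx mulr1 big1 ?addr0 ?expr2// => j ji.
by rewrite innerZr ow eq_sym (negbTE ji) mulr0.
Qed.

End inner_product.

(** * Orthonormal bases, adjoints and Hilbert--Schmidt norms *)

Lemma kernel_row (R : realType) (m n : nat) (M : 'M[R]_(m, n)) : (n < m)%N ->
  exists2 c : 'rV[R]_m, c != 0 & c *m M = 0.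
Proof.
move=> nm; have /rowV0Pn[c cM c0] : kermx M != 0.
  rewrite kermx_eq0 /row_free; apply: contraTneq nm => <-.
  by rewrite -leqNgt rank_leq_col.
by exists c => //; apply/sub_kermxP.
Qed.

Section orthonormal_bases.
Context {R : realType} (H : hilbertType R).
Local Notation "<[ x , y ]>" := (inner x y).

(** Counting equations, some nontrivial combination of [size q + 1] independent vectors is
    orthogonal to [q]; it would vanish if [q] spanned the space. *)
Lemma not_in_span (q : seq H) : infinite_dim H -> oseq q ->
  exists x, x <> oproj q x.
Proof.
move=> iH oq; apply: contrapT => hn.
have hq y : y = oproj q y by apply: contrapT => yq; apply: hn; exists y.
have [x xi] := iH (size q).+1.
have [c c0 cM] := kernel_row (\matrix_(i < (size q).+1, j < size q) <[x i, q`_j]>) (ltnSn _).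
have z0 : \sum_i c 0 i *: x i = 0.
  rewrite (hq (\sum_i _)) /oproj big_seq big1// => e eq.
  have [j jlt je] := nthP 0 eq.
  move/matrixP: cM => /(_ 0 (Ordinal jlt)); rewrite !mxE => cM.
  rewrite inner_suml (_ : \sum_i _ = 0) ?scale0r// -[RHS]cM -je.
  by apply: eq_bigr => i _; rewrite innerZl mxE.
by move/eqP: c0; apply; apply/rowP => i; rewrite mxE; exact: (xi _ z0).
Qed.

(** A vector is added even when [x] already lies in the span, so that the recursion over a dense
    sequence yields exactly one basis vector per step. *)
Lemma oseq_step (q : seq H) x : infinite_dim H -> oseq q ->
  exists f, oseq (f :: q) /\ oproj (f :: q) x = x.
Proof.
move=> iH oq; have [xE|xE] := EM (x = oproj q x); last first.
  have [f of_ [a a0 fE]] := oseq_residual oq xE.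
  by exists f; split=> //; exact: oseq_residual_span a0 fE.
have [y yE] := not_in_span iH oq.
have [f of_ _] := oseq_residual oq yE.
by exists f; split=> //; exact: (@oproj_catr _ _ [:: f]).
Qed.

Lemma exists_onb : separable H -> infinite_dim H ->
  exists e : nat -> H, orthonormal_basis e.
Proof.
move=> [D /countable_injP[f finj] dD] iH.
(* The point of [D] with code [n], or 0 if [n] is not a code. *)
pose d n := xget 0 [set x | D x /\ f x = n].
pose next q n := xget 0 [set g | oseq (g :: q) /\ oproj (g :: q) (d n) = d n].
pose Q := fix Q n := if n is m.+1 then next (Q m) m :: Q m else [::].
have nextP q n : oseq q -> oseq (next q n :: q) /\ oproj (next q n :: q) (d n) = d n.
  move=> oq; rewrite /next; case: xgetP => [g -> []//|none].
  by have [g gP] := oseq_step (d n) iH oq; have /(_ g)/(_ gP) := none.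
have oQ n : oseq (Q n) by elim: n => [//|n IH]; have [] := nextP _ n IH.
pose e n := next (Q n) n.
have QE F n : \sum_(x <- Q n) F x = \sum_(i < n) F (e i) :> H.
  elim: n => [|n IH]; first by rewrite big_nil big_ord0.
  by rewrite big_ord_recr big_cons /= addrC IH.
have eQ i j : (i < j)%N -> e i \in Q j.
  elim: j => // j IH; rewrite ltnS leq_eqVlt inE => /orP[/eqP->|/IH->].
    by rewrite eqxx.
  by rewrite orbT.
exists e; split.
  move=> i j; wlog ij : i j / (i <= j)%N.
    move=> h; have [ij|/ltnW ij] := leqP i j; first exact: h.
    by rewrite innerC eq_sym; exact: h.
  have [e1 eq0 _] := oQ j.+1.
  move: ij; rewrite leq_eqVlt => /orP[/eqP->|ij].
    by rewrite eqxx inner_normE e1 expr1n.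
  by rewrite innerC eq0 ?eQ// ltn_eqF.
move=> O O0 oO; have [x [Ox Dx]] := dD _ O0 oO; exists x; split => //.
have dE : d (f x) = x.
  rewrite /d; case: xgetP => [y -> [Dy fy]|/(_ x)]; last by case.
  by apply: finj => //; rewrite inE.
have [_ Px] := nextP (Q (f x)) (f x) (oQ _).
by exists (f x).+1, (fun i => <[x, e i]>); rewrite -[LHS]dE -[LHS]Px -(QE (fun g => <[x, g]> *: g)) dE.
Qed.

Lemma onbP : separable H -> infinite_dim H -> orthonormal_basis (onb H).
Proof.
by move=> sH iH; rewrite /onb; case: xgetP => // none; have [e /none] := exists_onb sH iH.
Qed.

Variables (e : nat -> H) (he : orthonormal_basis e).

Let pr n : seq H := map (fun i : 'I_n => e i) (index_enum 'I_n).

Lemma oseq_prefix n : oseq (pr n).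
Proof. by apply: oseq_family => i j; rewrite he.1. Qed.

Lemma proj_prefix n x : oproj (pr n) x = \sum_(i < n) <[x, e i]> *: e i.
Proof. by rewrite /oproj big_map. Qed.

(** A finite combination close to [x], given by density, competes with the Fourier sums of every
    longer prefix, and those are the best approximations. *)
Lemma onb_cvg x : (\sum_(i < n) <[x, e i]> *: e i) @[n --> \oo] --> x.
Proof.
apply/cvgrPdist_lt => eps eps0.
have [||y [xy [n [c yE]]]] := he.2 (ball x eps); first by exists x; exact: ballxx.
  exact: ball_open.
near=> N; rewrite -proj_prefix (le_lt_trans (best_approx x (oseq_prefix N) (y := y) _))//.
  rewrite yE oproj_sum; apply: eq_bigr => i _; rewrite oprojZ (oproj_mem (oseq_prefix N))//.
  have iN : (i < N)%N by apply: leq_trans (ltn_ord i) _; near: N; exact: nbhs_infty_ge.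
  by apply/mapP; exists (Ordinal iN) => //; rewrite mem_index_enum.
by move: xy; rewrite -ball_normE.
Unshelve. all: by end_near. Qed.

Lemma parseval_cvg x : \sum_(i < n) <[x, e i]> ^+ 2 @[n --> \oo] --> `|x| ^+ 2.
Proof.
rewrite (_ : (fun n => _) = (fun n => `|\sum_(i < n) <[x, e i]> *: e i| ^+ 2)).
  apply: (@cvg_comp _ _ _ _ (fun y : H => `|y| ^+ 2) _ (nbhs x)); first exact: onb_cvg.
  apply: (@continuous_comp _ _ _ (fun y : H => `|y|) (fun r : R => r ^+ 2)).
    exact: norm_continuous.
  exact: exprn_continuous.
apply/funext => n; rewrite -proj_prefix norm_oproj_sqr; last exact: oseq_prefix.
by rewrite big_map.
Qed.

Lemma parseval x : (\sum_(0 <= i <oo) (<[x, e i]> ^+ 2)%:E = (`|x| ^+ 2)%:E)%E.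
Proof.
apply/cvg_lim => //.
rewrite (_ : (fun n => _) = (fun n => (\sum_(i < n) <[x, e i]> ^+ 2)%:E)).
  by apply: cvg_EFin; [exact: nearW|exact: parseval_cvg].
by apply/funext => n; rewrite big_mkord sumEFin.
Qed.

End orthonormal_bases.

Section hilbert_schmidt_theory.
Context {R : realType} (H1 H2 : hilbertType R).
Hypothesis o1 : orthonormal_basis (onb H1).
Hypothesis o2 : orthonormal_basis (onb H2).
Local Notation "<[ x , y ]>" := (inner x y).

(** The square of [hs_norm]; without the root it can be summed and compared term by term. *)
Definition hs2 (K1 K2 : hilbertType R) (B : K1 -> K2) : \bar R :=
  (\sum_(0 <= i <oo) (`|B (onb K1 i)| ^+ 2)%:E)%E.

Lemma hs2_ge0 (K1 K2 : hilbertType R) (B : K1 -> K2) : (0 <= hs2 B)%E.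
Proof. by apply: nneseries_ge0 => n _ _; rewrite lee_fin sqr_ge0. Qed.

(** By Parseval both sides are the double series of the squared matrix entries, summed in the two
    possible orders. *)
Lemma hs2_adjoint (B : H1 -> H2) (B' : H2 -> H1) :
  (forall x y, <[B x, y]> = <[x, B' y]>) -> hs2 B = hs2 B'.
Proof.
move=> BB'; rewrite /hs2.
under eq_eseriesr do rewrite -(parseval o2).
rewrite nneseries_interchange; last by move=> *; rewrite lee_fin sqr_ge0.
apply: eq_eseriesr => j _; rewrite -(parseval o1).
by apply: eq_eseriesr => i _; rewrite BB' innerC.
Qed.

Lemma hs2_le (K1 K2 K3 : hilbertType R) (B : K1 -> K2) (B' : K1 -> K3) :
  (forall x, `|B x| <= `|B' x|) -> (hs2 B <= hs2 B')%E.
Proof.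
move=> h; apply: lee_nneseries => [i _ _|i _]; first by rewrite lee_fin sqr_ge0.
by rewrite lee_fin ler_sqr ?nnegrE.
Qed.

(** The adjoint at [y] is the series of [<A e_i, y> e_i]. Its coefficients are dominated by
    [|y| |A e_i|], which is square summable, so the partial sums are Cauchy; continuity of [A]
    carries the identity from finite sections to all [x]. *)
Lemma adjointP (A : {linear H1 -> H2}) x y : hilbert_schmidt A ->
  <[A x, y]> = <[x, adjoint A y]>.
Proof.
move=> [cA hsA]; rewrite /adjoint; case: xgetP => [z -> //|none].
pose e := onb H1; pose a i := <[A (e i), y]>.
have A2 : (hs2 A < +oo)%E by move: hsA; rewrite /hs_norm -/(hs2 A); case: (hs2 A) => [r||]; rewrite ?ltry.
have aB i : a i ^+ 2 <= `|y| ^+ 2 * `|A (e i)| ^+ 2.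
  by rewrite -exprMn mulrC -(real_normK (num_real _)) ler_sqr ?nnegrE ?mulr_ge0 ?cauchy_schwarz.
have tail : (\sum_(N <= k <oo) (`|A (e k)| ^+ 2)%:E)%E @[N --> \oo] --> 0%E.
  by apply: nneseries_tail_cvg => // k _; rewrite lee_fin sqr_ge0.
pose s n := \sum_(i < n) a i *: e i.
have dist n m : (n <= m)%N ->
    ((`|s n - s m| ^+ 2)%:E <= (`|y| ^+ 2)%:E * \sum_(n <= k <oo) (`|A (e k)| ^+ 2)%:E)%E.
  move=> nm; rewrite /s -!(big_mkord xpredT (fun i => a i *: e i)).
  rewrite [X in _ - X](@big_cat_nat _ _ _ n 0%N m)//= opprD addrA subrr sub0r normrN.
  rewrite (norm_orthonormal_sum _ (iota_uniq _ _) o1.1).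
  apply: (@le_trans _ _ ((`|y| ^+ 2)%:E * \sum_(n <= k < m) (`|A (e k)| ^+ 2)%:E)%E).
    rewrite sumEFin -EFinM lee_fin mulr_sumr; apply: ler_sum => i _; exact: aB.
  rewrite lee_wpmul2l ?lee_fin ?sqr_ge0//; apply: nneseries_lim_ge => k _ _.
  by rewrite lee_fin sqr_ge0.
have cz : cvgn s.
  apply: cauchy_cvg; apply: cauchy_exP => eps eps0.
  have c0 : 0 < eps ^+ 2 / (`|y| ^+ 2 + 1) by rewrite divr_gt0 ?exprn_gt0// ltr_wpDl ?sqr_ge0.
  have [N _ tN] : \forall N \near \oo, (\sum_(N <= k <oo) (`|A (e k)| ^+ 2)%:E < (eps ^+ 2 / (`|y| ^+ 2 + 1))%:E)%E.
    apply: (tail [set x | (x < _)%E]); apply: open_ereal_lt'.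
    by rewrite lte_fin.
  exists (s N), N => // n Nn; rewrite -ball_normE /ball_ /=.
  rewrite -ltr_sqr ?nnegrE ?(ltW eps0)// -lte_fin (le_lt_trans (dist _ _ Nn))//.
  move: (tN _ (leqnn N)) => /=.
  have : (0 <= \sum_(N <= k <oo) (`|A (e k)| ^+ 2)%:E)%E.
    by apply: nneseries_ge0 => k _ _; rewrite lee_fin sqr_ge0.
  case: (\sum_(N <= k <oo) _)%E => [r||]//; rewrite lee_fin lte_fin ltr_pdivlMr ?ltr_wpDl ?sqr_ge0//.
  rewrite -EFinM lte_fin mulrDr mulr1 => r0; apply: le_lt_trans.
  by rewrite mulrC lerDl.
(* The limit has the defining property of the adjoint, so the default value of [xget] cannot
   occur. *)
exfalso; apply: (none (lim (s @ \oo))) => u /=.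
set z := lim _.
have lhs : <[A (\sum_(i < n) <[u, e i]> *: e i), y]> @[n --> \oo] --> <[A u, y]>.
  apply: (@cvg_comp _ _ _ _ (fun v => <[A v, y]>) _ (nbhs u)); first exact: onb_cvg.
  under eq_fun do rewrite innerC.
  by rewrite innerC; apply: (@continuous_comp _ _ _ A (inner y)); [exact: cA|exact: continuous_inner].
have rhs : <[u, s n]> @[n --> \oo] --> <[u, z]>.
  by apply: (@cvg_comp _ _ _ _ (inner u) _ (nbhs z)); [exact: cz|exact: continuous_inner].
suff E : (fun n => <[A (\sum_(i < n) <[u, e i]> *: e i), y]>) = (fun n => <[u, s n]>).
  by rewrite E in lhs; exact: cvg_unique lhs rhs.
apply/funext => n; rewrite linear_sum inner_suml inner_sumr; apply: eq_bigr => i _.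
by rewrite linearZ innerZl innerZr mulrC.
Qed.

End hilbert_schmidt_theory.

(** * Normal laws *)

Section density.
Context d (T : measurableType d) (R : realType).
Variables (mu nu : {measure set T -> \bar R}) (g : T -> R).
Hypotheses (mg : measurable_fun setT g) (g0 : forall x, 0 <= g x).
Hypothesis nuE : forall A, measurable A -> (nu A = \int[mu]_(x in A) (g x)%:E)%E.
Local Open Scope ereal_scope.
Import HBNNSimple.

Let integral_density_nnsfun (f : {nnsfun T >-> R}) :
  \int[nu]_x (f x)%:E = \int[mu]_x ((f x)%:E * (g x)%:E).
Proof.
have indic (A : set T) : measurable A ->
    \int[nu]_x (\1_A x)%:E = \int[mu]_x ((\1_A x)%:E * (g x)%:E).
  move=> mA; rewrite integral_indic// setIT nuE// integral_mkcond.
  apply: eq_integral => x _; rewrite patchE indicE.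
  by case: (x \in A); rewrite ?mul1e ?mul0e.
under eq_integral do rewrite fimfunE -fsumEFin//.
rewrite ge0_integral_fsum//; last 2 first.
  - by move=> r; exact/measurable_EFinP/measurableT_comp.
  - by move=> n x _; rewrite nnfun_muleindic_ge0.
under [RHS]eq_integral.
  move=> x xD.
  rewrite fimfunE -fsumEFin// ge0_mule_fsuml; last first.
    by move=> r; rewrite nnfun_muleindic_ge0.
  over.
rewrite [RHS]ge0_integral_fsum//; last 2 first.
  - move=> r; apply: emeasurable_funM; last exact/measurable_EFinP.
    exact/measurable_EFinP/measurableT_comp.
  - by move=> n x _; apply: mule_ge0; rewrite ?EFinM ?nnfun_muleindic_ge0// lee_fin.
apply: eq_fsbigr => r _.
under eq_integral do rewrite EFinM.
under [RHS]eq_integral do rewrite EFinM -muleA.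
have [r0|r0] := leP 0%R r.
  rewrite !ge0_integralZl//; last 3 first.
  - apply: emeasurable_funM; last exact/measurable_EFinP.
    exact/measurable_EFinP/measurable_indic.
  - by move=> x _; rewrite mule_ge0 ?lee_fin ?indicE.
  - exact/measurable_EFinP/measurable_indic.
  by rewrite indic.
rewrite preimage_nnfun0//.
by rewrite !integral0_eq// => x _; rewrite indic0 ?mul0e ?mule0.
Qed.

Lemma ge0_integral_density (f : T -> \bar R) :
  measurable_fun setT f -> (forall x, 0 <= f x) ->
  \int[nu]_x f x = \int[mu]_x (f x * (g x)%:E).
Proof.
move=> mf f0.
pose f_ := nnsfun_approx measurableT mf.
transitivity (lim (\int[nu]_x (f_ n x)%:E @[n --> \oo])).
  rewrite -monotone_convergence//=.
  - apply: eq_integral => ? /[!inE] xD; apply/esym/cvg_lim => //=.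
    exact: cvg_nnsfun_approx.
  - by move=> n; exact/measurable_EFinP/measurable_funTS.
  - by move=> n ? _; rewrite lee_fin.
  - by move=> ? _ ? ? mn; rewrite lee_fin; exact/lefP/nd_nnsfun_approx.
under eq_fun do rewrite integral_density_nnsfun.
rewrite -monotone_convergence//=.
- apply: eq_integral => x _; apply/cvg_lim => //.
  apply: cvgeZr => //; exact: cvg_nnsfun_approx.
- move=> n; apply: emeasurable_funM; exact/measurable_EFinP.
- by move=> n ? _; rewrite mule_ge0 ?lee_fin.
- by move=> ? _ ? ? ?; rewrite lee_wpmul2r ?lee_fin//; exact/lefP/nd_nnsfun_approx.
Qed.

End density.

Section affine_change_of_variables.
Context {R : realType}.
Local Notation mu := (@lebesgue_measure R).
Variables (c a : R).
Hypothesis c0 : c != 0.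

Let aff (x : measurableTypeR R) : measurableTypeR R := c * x + a.

Let maff : measurable_fun setT aff.
Proof. by apply: measurable_funD => //; apply: measurable_funM. Qed.

Let affine_measure : {measure set (measurableTypeR R) -> \bar R} :=
  mscale (NngNum (normr_ge0 c))
    (measure_function_pushforward__canonical__measure_function_Measure mu maff).

Let lebesgue_measure_affine (A : set (measurableTypeR R)) :
  measurable A -> affine_measure A = mu A.
Proof.
(* Lebesgue measure is determined by its values on half-open intervals. For negative [c] the
   preimage of such an interval is half-open at the other end, whence the two cases. *)
move=> mA; apply/esym/lebesgue_measure_unique => //= _ [[x y]] _ <-.
change (mu `]x, y]%classic = `|c|%:E * mu (aff @^-1` `]x, y]%classic))%E.
have [cp|cn] := ltP 0 c.
  rewrite (_ : aff @^-1` _ = `](x - a) / c, (y - a) / c]%classic); last first.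
    apply/seteqP; split => z /=; rewrite !in_itv/= /aff;
    by rewrite ltr_pdivrMr// ler_pdivlMr// ltrBlDr lerBrDr mulrC.
  rewrite !lebesgue_measure_itv/= !lte_fin ltr_pM2r ?invr_gt0// ltrD2r.
  case: ifPn => _; last by rewrite mule0.
  rewrite gtr0_norm// -!EFinB -EFinM; congr (_%:E).
  by field.
have {cn} cn : c < 0 by rewrite lt_neqAle c0.
rewrite (_ : aff @^-1` _ = `[(y - a) / c, (x - a) / c[%classic); last first.
  apply/seteqP; split => z /=; rewrite !in_itv/= /aff;
  by rewrite ltr_ndivlMr// ler_ndivrMr// ltrBlDr lerBrDr mulrC andbC.
rewrite !lebesgue_measure_itv/= !lte_fin ltr_nM2r ?invr_lt0// ltrD2r.
case: ifPn => _; last by rewrite mule0.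
rewrite ltr0_norm// -!EFinB -EFinM; congr (_%:E).
by field.
Qed.

Lemma ge0_integral_affine (f : R -> \bar R) :
  measurable_fun setT f -> (forall x, 0 <= f x)%E ->
  (\int[mu]_x f x = `|c|%:E * \int[mu]_x f (c * x + a)%R)%E.
Proof.
move=> mf f0.
rewrite (eq_measure_integral affine_measure); last first.
  by move=> A mA _ /=; rewrite -lebesgue_measure_affine.
rewrite ge0_integral_mscale//=; congr (_ * _)%E.
by rewrite ge0_integral_pushforward.
Qed.

End affine_change_of_variables.

Section normal_identities.
Context {R : realType}.
Implicit Types s t m x z : R.

Lemma normal_peakE s : normal_peak s = `|s|^-1 * normal_peak 1.
Proof.
rewrite /normal_peak expr1n mul1r -mulrnAr sqrtrM ?sqr_ge0//.
by rewrite sqrtr_sqr invfM.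
Qed.

Lemma normal_pdf_affine m s x : s != 0 ->
  `|s| * normal_pdf m s (s * x + m) = normal_pdf 0 1 x.
Proof.
move=> s0; rewrite !normal_pdfE ?oner_neq0// (normal_peakE s) !mulrA mulfV ?normr_eq0// mul1r.
congr (_ * _); rewrite /normal_fun; congr expR; rewrite expr1n !mulr2n subr0.
by field; rewrite -mulr2n mulrn_eq0 sqrf_eq0.
Qed.

(** Completing the square. The joint density of x and z = s x + t y is factored as the law of x
    times that of z given x, and as the law of z times that of x given z. *)
Lemma normal_pdf_convolution s t x z : t != 0 -> let r := Num.sqrt (s ^+ 2 + t ^+ 2) in
  normal_pdf 0 1 x * normal_pdf (s * x) t z =
  normal_pdf 0 r z * normal_pdf (s * z / r ^+ 2) (t / r) x.
Proof.
move=> t0 r.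
have t2 : 0 < t ^+ 2 by rewrite exprn_even_gt0.
have r2 : r ^+ 2 = s ^+ 2 + t ^+ 2 by rewrite sqr_sqrtr// addr_ge0 ?sqr_ge0.
have r20 : s ^+ 2 + t ^+ 2 != 0 by rewrite gt_eqF// ltr_wpDl ?sqr_ge0.
have r0 : r != 0 by rewrite -sqrf_eq0 r2.
rewrite !normal_pdfE ?oner_neq0 ?mulf_neq0 ?invr_neq0//.
rewrite (normal_peakE t) (normal_peakE r) (normal_peakE (t / r)) normrM normfV.
rewrite /normal_fun mulrACA [RHS]mulrACA -!expRD; congr (_ * expR _).
  by field; rewrite !normr_eq0 r0.
rewrite expr1n !mulr2n !expr_div_n r2 !subr0.
by field; rewrite -!mulr2n !mulrn_eq0 r20 sqrf_eq0 t0.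
Qed.

End normal_identities.

Section normal_laws.
Context {R : realType}.
Local Notation N1 := (@normal_prob R 0 1).
Local Notation mu := (@lebesgue_measure R).

Lemma measurable_mul_add (s m : R) : measurable_fun setT (fun x : R => s * x + m).
Proof. by apply: measurable_funD => //; apply: measurable_funM. Qed.

Lemma ge0_integral_N1 (f : R -> \bar R) :
  measurable_fun setT f -> (forall x, 0 <= f x)%E ->
  (\int[N1]_x f x = \int[mu]_x (f x * (normal_pdf 0 1 x)%:E))%E.
Proof.
move=> mf f0; apply: ge0_integral_density => //.
- exact: measurable_normal_pdf.
- by move=> x; exact: normal_pdf_ge0.
Qed.

Lemma normal_probE (m s : R) (B : set R) : s != 0 -> measurable B ->
  normal_prob m s B = N1 ((fun x => s * x + m) @^-1` B).
Proof.
move=> s0 mB; rewrite /normal_prob integral_mkcond [RHS]integral_mkcond.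
rewrite (@ge0_integral_affine _ s m s0); last 2 first.
- apply/(measurable_restrictT _ mB)/measurable_funTS/measurable_EFinP.
  exact: measurable_normal_pdf.
- by move=> x; rewrite patchE; case: ifP => // _; rewrite lee_fin normal_pdf_ge0.
rewrite -ge0_integralZl//; last 2 first.
- apply/measurableT_comp => //; last exact: measurable_mul_add.
  apply/(measurable_restrictT _ mB)/measurable_funTS/measurable_EFinP.
  exact: measurable_normal_pdf.
- by move=> x _; rewrite patchE; case: ifP => // _; rewrite lee_fin normal_pdf_ge0.
apply: eq_integral => x _; rewrite !patchE /=.
have -> : (x \in (fun x => s * x + m) @^-1` B) = (s * x + m \in B).
  by apply/idP/idP; rewrite !inE.
by case: ifP => _; rewrite ?mule0// -EFinM normal_pdf_affine.
Qed.

Lemma centered_normalE (v : R) (B : set R) : 0 <= v -> measurable B ->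
  centered_normal v B = N1 ((fun x => Num.sqrt v * x) @^-1` B).
Proof.
move=> v0 mB; rewrite /centered_normal; case: eqVneq => [->|vn0].
  rewrite sqrtr0; have -> : (fun x : R => 0 * x) @^-1` B = if 0 \in B then setT else set0.
    apply/seteqP; split => x /=; rewrite mul0r; first by move=> /mem_set ->.
    by case: ifPn => // /set_mem.
  rewrite diracE; case: ifPn => _; last by rewrite measure0.
  by rewrite probability_setT.
rewrite normal_probE//; last by rewrite gt_eqF// sqrtr_gt0 lt_neqAle eq_sym vn0.
by under eq_fun do rewrite addr0.
Qed.


Lemma measurable_scale (s : R) (B : set R) : measurable B ->
  measurable ((fun x : R => s * x) @^-1` B).
Proof. by move=> mB; rewrite -[X in measurable X]setTI; apply: measurable_funM. Qed.

Lemma N1_norm (s : R) (B : set R) : measurable B ->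
  N1 ((fun x => s * x) @^-1` B) = N1 ((fun x => `|s| * x) @^-1` B).
Proof.
move=> mB; have [->|s0] := eqVneq s 0; first by rewrite normr0.
have add0 c : (fun x : R => c * x) = (fun x => c * x + 0) by apply/funext => x; rewrite addr0.
rewrite !add0 -!normal_probE ?normr_eq0//; apply: eq_integral => x _.
rewrite !normal_pdfE ?normr_eq0// (normal_peakE s) (normal_peakE `|s|) normr_id.
by rewrite /normal_fun real_normK ?num_real.
Qed.

(** After Fubini the density of the sum at z is an integral over x of the joint density. In its
    second factorization the conditional density of x integrates to 1. *)
Lemma N1_convolution (s t : R) (B : set R) : measurable B ->
  (\int[N1]_x N1 ((fun y => s * x + t * y)%R @^-1` B) =
   N1 ((fun x => Num.sqrt (s ^+ 2 + t ^+ 2) * x)%R @^-1` B))%E.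
Proof.
move=> mB; have [->|t0] := eqVneq t 0.
  (* For [t = 0] the inner law is a point mass and has no density. *)
  rewrite expr0n addr0 sqrtr_sqr -N1_norm//.
  transitivity (\int[N1]_x (\1_((fun x => s * x)%R @^-1` B) x)%:E)%E; last first.
    by rewrite integral_indic ?setIT//; exact: measurable_scale.
  apply: eq_integral => x _; rewrite indicE.
  have -> : (fun y : R => s * x + 0 * y) @^-1` B =
      if x \in (fun x => s * x) @^-1` B then setT else set0.
    by apply/seteqP; split => y /=; rewrite mul0r addr0; case: ifPn => //;
      rewrite ?inE ?notin_setE.
  by case: ifPn => _; rewrite ?probability_setT ?measure0.
set r := Num.sqrt _.
have r0 : r != 0.
  by rewrite gt_eqF// sqrtr_gt0 ltr_wpDl ?sqr_ge0// exprn_even_gt0.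
have E x : N1 ((fun y => s * x + t * y)%R @^-1` B) =
    (\int[mu]_z ((\1_B z)%:E * (normal_pdf (s * x) t z)%:E))%E.
  under eq_fun do rewrite addrC.
  rewrite -normal_probE// /normal_prob integral_mkcond; apply: eq_integral => z _.
  by rewrite patchE indicE; case: ifP; rewrite ?mul1e ?mul0e.
under eq_integral do rewrite E.
have mpdf : measurable_fun setT (fun xz : R * R => normal_pdf (s * xz.1) t xz.2).
  rewrite /normal_pdf (negbTE t0); apply: measurable_funM => //.
  apply: measurableT_comp => //=; apply: measurable_funM => //=.
  apply: measurableT_comp => //=; apply: measurable_funX => //=.
  by apply: measurable_funB => //; apply: measurable_funM.
have mF : measurable_fun setT (fun xz : R * R =>
    ((\1_B xz.2)%:E * (normal_pdf (s * xz.1) t xz.2)%:E) * (normal_pdf 0 1 xz.1)%:E)%E.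
  apply: emeasurable_funM; last first.
    by apply/measurable_EFinP/(measurableT_comp (measurable_normal_pdf _ _)).
  apply: emeasurable_funM; last exact/measurable_EFinP.
  by apply/measurable_EFinP/(measurableT_comp (measurable_indic mB)).
have F0 (xz : R * R) : (0 <= ((\1_B xz.2)%:E * (normal_pdf (s * xz.1) t xz.2)%:E) *
    (normal_pdf 0 1 xz.1)%:E)%E.
  by rewrite !mule_ge0 ?lee_fin ?normal_pdf_ge0.
rewrite ge0_integral_N1; last 2 first.
- apply: (@measurable_fun_fubini_tonelli_F _ _ _ _ _ mu
    (fun xz : R * R => ((\1_B xz.2)%:E * (normal_pdf (s * xz.1) t xz.2)%:E)%E)).
    apply: emeasurable_funM; last exact/measurable_EFinP.
    by apply/measurable_EFinP/(measurableT_comp (measurable_indic mB)).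
  by move=> xz; rewrite mule_ge0 ?lee_fin ?normal_pdf_ge0.
- by move=> x; apply: integral_ge0 => z _; rewrite mule_ge0 ?lee_fin ?normal_pdf_ge0.
transitivity (\int[mu]_x \int[mu]_z ((\1_B z)%:E * (normal_pdf (s * x) t z)%:E * (normal_pdf 0 1 x)%:E))%E.
  apply: eq_integral => x _; rewrite ge0_integralZr//.
  - apply: emeasurable_funM; last by apply/measurable_EFinP; exact: measurable_normal_pdf.
    by apply/measurable_EFinP; exact: measurable_indic.
  - by move=> z _; rewrite mule_ge0// lee_fin normal_pdf_ge0.
  - by rewrite lee_fin normal_pdf_ge0.
apply: etrans; first exact: (@fubini_tonelli _ _ _ _ _ mu mu _ mF F0).
transitivity (\int[mu]_z ((\1_B z)%:E * (normal_pdf 0 r z)%:E))%E; last first.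
  rewrite (_ : (fun x => r * x) = (fun x => r * x + 0)); last by apply/funext => x; rewrite addr0.
  rewrite -normal_probE// /normal_prob [RHS]integral_mkcond; apply: eq_integral => z _.
  by rewrite patchE indicE; case: ifP; rewrite ?mul1e ?mul0e.
apply: eq_integral => z _ /=.
under eq_integral do rewrite -muleA -EFinM [normal_pdf (_ * _) _ _ * _]mulrC normal_pdf_convolution// -/r !EFinM muleA.
rewrite ge0_integralZl//; first by rewrite integral_normal_pdf mule1.
- by apply/measurable_EFinP; exact: measurable_normal_pdf.
- by move=> x _; rewrite lee_fin normal_pdf_ge0.
- by rewrite mule_ge0 ?lee_fin ?normal_pdf_ge0.
Qed.

Section law.
Context d (T : measurableType d) (P : probability T R).

Definition normal_law (X : T -> R) (v : R) :=
  forall B : set R, measurable B -> P (X @^-1` B) = centered_normal v B.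


Lemma ge0_integral_normal_law (X : T -> R) (v : R) (f : R -> \bar R) :
  measurable_fun setT X -> normal_law X v -> 0 <= v ->
  measurable_fun setT f -> (forall x, 0 <= f x)%E ->
  (\int[P]_x f (X x) = \int[N1]_x f (Num.sqrt v * x)%R)%E.
Proof.
move=> mX lX v0 mf f0.
have msv : measurable_fun setT (fun x : R => Num.sqrt v * x) by exact: measurable_funM.
transitivity (\int[pushforward P X]_y f y)%E; first by rewrite ge0_integral_pushforward.
transitivity (\int[pushforward N1 (fun x => Num.sqrt v * x)%R]_y f y)%E; last first.
  by rewrite ge0_integral_pushforward.
apply: eq_measure_integral => A mA _.
by rewrite /= /pushforward lX// centered_normalE.
Qed.

(* The factor [8] is not sharp: the integral is the variance [v]. *)
Lemma normal_law_second_moment (X : T -> R) (v : R) :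
  measurable_fun setT X -> normal_law X v -> 0 <= v ->
  (\int[P]_x (X x ^+ 2)%:E <= (8 * v)%:E)%E.
Proof.
move=> mX lX v0.
have mx2 : measurable_fun setT (fun x : R => (x ^+ 2)%:E).
  by apply/measurable_EFinP; exact: measurable_funX.
rewrite (ge0_integral_normal_law (f := fun x => (x ^+ 2)%:E) mX lX)//; last first.
  by move=> x; rewrite lee_fin sqr_ge0.
rewrite ge0_integral_N1//=; last 2 first.
- by apply: (measurableT_comp mx2); exact: measurable_funM.
- by move=> x; rewrite lee_fin sqr_ge0.
have s2 : Num.sqrt 2 != 0 :> R by rewrite gt_eqF// sqrtr_gt0.
(* From 1 + u <= exp u with u = x^2 / 4 follows x^2 exp(-x^2/2) <= 4 exp(-x^2/4), a multiple of the
   density of variance 2. The factor 8 then comes from 4 sqrt 2 <= 8. *)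
have bound x : (Num.sqrt v * x) ^+ 2 * normal_pdf 0 1 x <=
    8 * v * normal_pdf 0 (Num.sqrt 2) x.
  rewrite exprMn sqr_sqrtr// [8 * v]mulrC -!mulrA ler_wpM2l//.
  rewrite !normal_pdfE ?oner_neq0// (normal_peakE (Num.sqrt 2)).
  rewrite /normal_fun !subr0 expr1n sqr_sqrtr// ger0_norm ?sqrtr_ge0//.
  have := expR_ge1Dx (x ^+ 2 / 4).
  have -> : - x ^+ 2 / (1 *+ 2) = - x ^+ 2 / (2 *+ 2) - x ^+ 2 / 4 by field.
  rewrite expRD expRN; set e := expR (- _ / _); set E := expR _ => hE.
  have e0 : 0 < e by exact: expR_gt0.
  have E0 : 0 < E by exact: expR_gt0.
  have pk : 0 < normal_peak (1 : R) by rewrite normal_peak_gt0// oner_neq0.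
  have x4 : x ^+ 2 / E <= 4 by rewrite ler_pdivrMr//; nra.
  have sq : 4 <= 8 * (Num.sqrt 2)^-1 :> R.
    rewrite ler_pdivlMr ?sqrtr_gt0//.
    have : Num.sqrt 2 <= 2 :> R by rewrite -[leRHS]ger0_norm// -sqrtr_sqr ler_sqrt//; lra.
    by lra.
  have -> : x * (x * (normal_peak 1 * (e / E))) = (x ^+ 2 / E) * (normal_peak 1 * e).
    by field; rewrite gt_eqF.
  have -> : 8 * ((Num.sqrt 2)^-1 * normal_peak 1 * e) = (8 / Num.sqrt 2) * (normal_peak 1 * e).
    by field; rewrite s2.
  by rewrite ler_wpM2r ?mulr_ge0 ?(ltW pk) ?(ltW e0)// (le_trans x4 sq).
apply: (@le_trans _ _ (\int[mu]_x ((8 * v)%:E * (normal_pdf 0 (Num.sqrt 2) x)%:E))%E).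
  apply: ge0_le_integral => //.
  - by move=> x _; rewrite mule_ge0 ?lee_fin ?sqr_ge0 ?normal_pdf_ge0.
  - apply: emeasurable_funM; last by apply/measurable_EFinP; exact: measurable_normal_pdf.
    by apply: (measurableT_comp mx2); exact: measurable_funM.
  - apply: emeasurable_funM => //.
    by apply/measurable_EFinP; exact: measurable_normal_pdf.
  - by move=> x _; rewrite -!EFinM lee_fin bound.
rewrite ge0_integralZl//.
- by rewrite integral_normal_pdf mule1.
- by apply/measurable_EFinP; exact: measurable_normal_pdf.
- by move=> x _; rewrite lee_fin normal_pdf_ge0.
- by rewrite lee_fin mulr_ge0.
Qed.

End law.

Lemma normal_law_add d1 d2 (T1 : measurableType d1) (T2 : measurableType d2)
    (P1 : probability T1 R) (P2 : probability T2 R) (X : T1 -> R) (Y : T2 -> R) v w :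
  measurable_fun setT X -> measurable_fun setT Y -> 0 <= v -> 0 <= w ->
  normal_law P1 X v -> normal_law P2 Y w ->
  normal_law (P1 \x P2)%E (fun z => X z.1 + Y z.2) (v + w).
Proof.
move=> mX mY v0 w0 lX lY B mB.
have E : v + w = Num.sqrt v ^+ 2 + Num.sqrt w ^+ 2 by rewrite !sqr_sqrtr.
rewrite centered_normalE ?addr_ge0// E -N1_convolution//.
have shift_meas (x : R) : measurable ((fun y : R => x + y) @^-1` B).
  by rewrite -[X in measurable X]setTI; apply: measurable_funD.
pose h x := N1 ((fun y => x + Num.sqrt w * y) @^-1` B).
have mh : measurable_fun setT h.
  have mS : measurable ((fun z : R * R => z.1 + Num.sqrt w * z.2) @^-1` B).
    rewrite -[X in measurable X]setTI; apply: measurable_funD => //.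
    by apply: measurable_funM => //.
  rewrite (_ : h = N1 \o xsection ((fun z : R * R => z.1 + Num.sqrt w * z.2) @^-1` B)).
    exact: measurable_fun_xsection.
  apply/funext => x; rewrite /h /=; congr (N1 _).
  by apply/seteqP; split => y /=; rewrite /xsection /= inE.
transitivity (\int[P1]_x h (X x))%E; last by rewrite (ge0_integral_normal_law mX lX).
apply: eq_integral => x _ /=; rewrite /h.
transitivity (P2 (Y @^-1` ((fun y => X x + y) @^-1` B))).
  by congr (P2 _); apply/seteqP; split => y /=; rewrite /xsection /= inE.
by rewrite lY// centered_normalE.
Qed.

Lemma tnth_tuple_cons d (T : measurableType d) n (z : T * n.-tuple T) i :
  tnth (tuple_cons z) (lift ord0 i) = tnth z.2 i.
Proof. by rewrite /tuple_cons tnthS. Qed.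

Lemma normal_law_power n (b : 'I_n -> R) :
  normal_law (power_prob N1 n) (fun z => \sum_i b i * tnth z i) (\sum_i b i ^+ 2).
Proof.
elim: n b => [b B mB|n IH b B mB].
  rewrite big_ord0 (_ : centered_normal 0 B = \d_(0 : R) B); last by rewrite /centered_normal; case: eqP.
  rewrite [LHS]diracE [RHS]diracE; congr ((nat_of_bool _)%:R%:E).
  by apply/idP/idP; rewrite !inE /= big_ord0.
rewrite big_ord_recl.
have l1 : normal_law N1 (fun x : R => b ord0 * x) (b ord0 ^+ 2).
  move=> C mC; rewrite centered_normalE ?sqr_ge0// sqrtr_sqr.
  by rewrite -N1_norm.
have mX : measurable_fun setT (fun x : measurableTypeR R => b ord0 * x) by exact: measurable_funM.
have mY : measurable_fun setT (fun z : n.-tuple (measurableTypeR R) => \sum_i b (lift ord0 i) * tnth z i).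
  apply: measurable_sum => i; apply: measurable_funM => //; exact: measurable_tnth.
have := normal_law_add mX mY (sqr_ge0 _) _ l1 (IH (fun i => b (lift ord0 i))).
move=> /(_ _ _ mB) <-; last by apply: sumr_ge0 => i _; rewrite sqr_ge0.
rewrite /= /distribution /pushforward.
have E (z : measurableTypeR R * n.-tuple (measurableTypeR R)) :
    \sum_(i < n.+1) b i * tnth (tuple_cons z) i =
    b ord0 * z.1 + \sum_i b (lift ord0 i) * tnth z.2 i.
  rewrite big_ord_recl; congr (_ + _); apply: eq_bigr => i _.
  by rewrite tnth_tuple_cons.
by congr (_ _); apply/seteqP; split => z /=; rewrite E.
Qed.

End normal_laws.

(** * Measures with the same one-dimensional marginals *)

Section threshold_polynomials.
Context {R : realType}.
Implicit Types (q w y : R) (n : nat).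

Lemma bernoulli_ineq n y : -1 <= y -> 1 + n%:R * y <= (1 + y) ^+ n.
Proof.
move=> y1; elim: n => [|n IH]; first by rewrite mul0r addr0 expr0.
rewrite exprS; apply: (@le_trans _ _ ((1 + y) * (1 + n%:R * y))).
  rewrite -natr1; have : 0 <= n%:R * (y * y) by rewrite mulr_ge0// -expr2 sqr_ge0.
  by lra.
by rewrite ler_wpM2l//; lra.
Qed.

(** With [s = sqrt q], one factor [s ^+ n] absorbs [n] by Bernoulli's inequality and the other one
    tends to 0. *)
Lemma cvg_natrM_expr q : 0 <= q -> q < 1 -> n%:R * q ^+ n @[n --> \oo] --> 0.
Proof.
move=> q0 q1; pose s := Num.sqrt q.
have s0 : 0 <= s by exact: sqrtr_ge0.
have s1 : s < 1 by rewrite -[ltRHS]sqrtr1 ltr_sqrt.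
have qs : q = s ^+ 2 by rewrite sqr_sqrtr.
have h n : 0 <= n%:R * q ^+ n <= (1 - s)^-1 * s ^+ n.
  rewrite mulr_ge0 ?exprn_ge0//= qs -exprM mulnC exprM expr2 mulrA ler_wpM2r ?exprn_ge0//.
  have [s00|s00] := eqVneq s 0.
    rewrite s00 subr0 invr1; case: n => [|n]; first by rewrite mul0r.
    by rewrite expr0n mulr0.
  have sp : 0 < s by rewrite lt_neqAle eq_sym s00.
  have sn : 0 < s ^+ n by rewrite exprn_gt0.
  rewrite -ler_pdivlMr// ler_pdivlMl ?subr_gt0// -exprVn.
  have : -1 <= s^-1 - 1 by rewrite lerBrDl addrN invr_ge0.
  move=> /(bernoulli_ineq n); rewrite [1 + (s^-1 - 1)]addrC subrK; apply: le_trans.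
  have : s^-1 - 1 = (1 - s) * s^-1 by field.
  move=> ->; have s11 : 1 <= s^-1 by rewrite invf_ge1 // ltW.
  have : 0 <= n%:R * ((1 - s) * (s^-1 - 1)) by rewrite !mulr_ge0 ?subr_ge0// ltW.
  by lra.
apply: (squeeze_cvgr _ (cvg_cst 0)); first by apply: nearW => n; exact: h.
rewrite -[X in _ --> X](mulr0 (1 - s)^-1); apply: cvgMr; apply: cvg_expr.
by rewrite ger0_norm.
Qed.

(** Polynomials in [w] that converge to a step at 1/2. With N = n 2^n one has N w^n = n (2w)^n,
    which tends to infinity for w >= 1/2 and to 0 below; the factor n puts the point 1/2 itself on
    the upper side. *)
Lemma cvg_threshold w : 0 <= w <= 1 ->
  1 - (1 - w ^+ n) ^+ (n * 2 ^ n) @[n --> \oo] --> ((2^-1 <= w)%R%:R : R).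
Proof.
move=> /andP[w0 w1].
have y01 n : 0 <= w ^+ n <= 1 by rewrite exprn_ge0// exprn_ile1.
have Ny n : (n * 2 ^ n)%:R * w ^+ n = n%:R * (2 * w) ^+ n.
  by rewrite natrM natrX -mulrA -exprMn.
have [wh|wh] := leP 2^-1 w.
  rewrite -[X in _ --> X]subr0; apply: cvgB; first exact: cvg_cst.
  apply: (squeeze_cvgr _ (cvg_cst 0) cvg_harmonic); apply: nearW => n.
  have /andP[y0 y1] := y01 n; rewrite exprn_ge0 ?subr_ge0//=.
  have n0 : 0 < n.+1%:R :> R by rewrite ltr0n.
  rewrite -[leRHS]mul1r ler_pdivlMr//.
  (* With y = w^n, Bernoulli gives (1 + y)^N >= 1 + N y >= n + 1, while (1 - y)^N (1 + y)^N = (1 -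
     y^2)^N is at most 1. *)
  apply: (@le_trans _ _ ((1 - w ^+ n) ^+ (n * 2 ^ n) * (1 + w ^+ n) ^+ (n * 2 ^ n))).
    rewrite ler_wpM2l ?exprn_ge0 ?subr_ge0//.
    apply: le_trans (bernoulli_ineq _ _); last by lra.
    rewrite Ny -natr1 addrC lerD2l ler_peMr// exprn_ege1//; lra.
  rewrite -exprMn exprn_ile1//; nra.
rewrite -[X in _ --> X](subrr 1); apply: cvgB; first exact: cvg_cst.
apply: (@squeeze_cvgr _ _ _ _ (fun n => 1 - n%:R * (2 * w) ^+ n) (cst 1)); last exact: cvg_cst.
  apply: nearW => n; have /andP[y0 y1] := y01 n; apply/andP; split.
    have : -1 <= - w ^+ n by lra.
    by move=> /(bernoulli_ineq (n * 2 ^ n)); rewrite mulrN Ny; exact.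
  by rewrite exprn_ile1//; lra.
rewrite -[X in _ --> X]subr0; apply: cvgB; first exact: cvg_cst.
by apply: cvg_natrM_expr; lra.
Qed.

(** As the frequency tends to 0, the argument enters the interval around 0 where the sine has the
    sign of its argument. This is how periodic functions yield the indicator of a half-line. *)
Lemma cvg_sin_sign y :
  ((0 <= sin (y / k.+1%:R))%R%:R : R) @[k --> \oo] --> ((0 <= y)%R%:R : R).
Proof.
apply: cvg_near_cst; near=> k.
have k0 : 0 < k.+1%:R :> R by rewrite ltr0n.
have yk : `|y / k.+1%:R| < 2.
  rewrite normrM normfV (gtr0_norm k0) ltr_pdivrMr//.
  have : `|y| < k%:R by near: k; exact: nbhs_infty_gtr.
  by rewrite -natr1; lra.
congr (nat_of_bool _)%:R; have [y0|y0] := leP 0 y.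
  apply: sin_ge0_pi; rewrite divr_ge0//= (le_trans (ler_norm _))// ltW// (lt_le_trans yk)//.
  exact: pi_ge2.
apply/negbTE; rewrite -ltNge -oppr_gt0 -sinN; apply: sin2_gt0.
move: yk; rewrite -normrN => yk; rewrite (le_lt_trans (ler_norm _) yk) andbT.
by rewrite oppr_gt0 pmulr_llt0 ?invr_gt0.
Unshelve. all: by end_near. Qed.

End threshold_polynomials.

Section bounded_measurable.
Context d (T : measurableType d) (R : realType) (P : probability T R).
Implicit Types f g : T -> R.

Definition bmeas f := measurable_fun setT f /\ exists M, forall x, `|f x| <= M.

Lemma bmeas_cst c : bmeas (cst c).
Proof. by split => //; exists `|c|. Qed.

Lemma bmeasM f g : bmeas f -> bmeas g -> bmeas (fun x => f x * g x).
Proof.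
move=> [mf [M fM]] [mg [N gN]]; split; first exact: measurable_funM.
by exists (M * N) => x; rewrite normrM ler_pM.
Qed.

Lemma bmeasD f g : bmeas f -> bmeas g -> bmeas (fun x => f x + g x).
Proof.
move=> [mf [M fM]] [mg [N gN]]; split; first exact: measurable_funD.
by exists (M + N) => x; rewrite (le_trans (ler_normD _ _))// lerD.
Qed.

Lemma bmeas_integrable f : bmeas f -> P.-integrable setT (EFin \o f).
Proof.
move=> [mf [M fM]]; apply: measurable_bounded_integrable => //.
  by rewrite (le_lt_trans (probability_le1 P measurableT)) ?ltry.
exists M; split; first exact: num_real.
by move=> y My x _ /=; rewrite (le_trans (fM x))// ltW.
Qed.

Definition mean f : \bar R := (\int[P]_x (f x)%:E)%E.

Lemma meanD f g : bmeas f -> bmeas g ->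
  mean (fun x => f x + g x) = (mean f + mean g)%E.
Proof. by move=> bf bg; rewrite -integralD//; exact: bmeas_integrable. Qed.

Lemma meanZ c f : bmeas f -> mean (fun x => c * f x) = (c%:E * mean f)%E.
Proof. by move=> bf; rewrite -integralZl//; exact: bmeas_integrable. Qed.

Lemma mean_cvg (f_ : nat -> T -> R) f M : (forall n, measurable_fun setT (f_ n)) ->
  (forall n x, `|f_ n x| <= M) -> (forall x, f_ n x @[n --> \oo] --> f x) ->
  bmeas f /\ mean (f_ n) @[n --> \oo] --> mean f.
Proof.
move=> mf_ f_M f_f.
have mf : measurable_fun setT f.
  by apply: (measurable_fun_cvg mf_) => x _; exact: f_f.
split.
  split => //; exists M => x.
  have : `|f_ n x| @[n --> \oo] --> `|f x| by apply: cvg_norm; exact: f_f.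
  move=> h; rewrite -(cvg_lim _ h)//; apply: limr_le; first exact: cvgP h.
  exact: nearW.
have [|||||_ _] := @dominated_convergence _ _ _ P setT measurableT
  (fun n x => (f_ n x)%:E) (fun x => (f x)%:E) (cst M%:E).
- by move=> n; exact/measurable_EFinP.
- exact/measurable_EFinP.
- by apply: aeW => x _; apply: cvg_EFin; [exact: nearW|exact: f_f].
- exact: finite_measure_integrable_cst.
- by apply: aeW => x n _ /=; rewrite lee_fin.
- exact.
Qed.

End bounded_measurable.

Section identically_distributed_fields.
Context {R : realType} (V : lmodType R).
Context d1 d2 (T1 : measurableType d1) (T2 : measurableType d2).
Variables (P1 : probability T1 R) (P2 : probability T2 R).
Variables (L1 : V -> T1 -> R) (L2 : V -> T2 -> R).
Hypotheses (mL1 : forall v, measurable_fun setT (L1 v)).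
Hypotheses (mL2 : forall v, measurable_fun setT (L2 v)).
Hypotheses (L1D : forall u v x, L1 (u + v) x = L1 u x + L1 v x).
Hypotheses (L2D : forall u v x, L2 (u + v) x = L2 u x + L2 v x).
Hypotheses (L1Z : forall a v x, L1 (a *: v) x = a * L1 v x).
Hypotheses (L2Z : forall a v x, L2 (a *: v) x = a * L2 v x).
Hypothesis L12 : forall v B, measurable B -> P1 (L1 v @^-1` B) = P2 (L2 v @^-1` B).

Let cos1 v e x := cos (L1 v x + e).
Let cos2 v e x := cos (L2 v x + e).

(* Pairs with the same integrals against all [cos (L v + e)]. The functions
   multiplying them into such pairs form an algebra, closed under bounded
   pointwise limits, which contains every [cos (L v + e)]. *)
Definition same (g1 : T1 -> R) (g2 : T2 -> R) := [/\ bmeas g1, bmeas g2 &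
  forall v e, mean P1 (fun x => g1 x * cos1 v e x) = mean P2 (fun x => g2 x * cos2 v e x)].

Definition stable (u1 : T1 -> R) (u2 : T2 -> R) := forall g1 g2, same g1 g2 ->
  same (fun x => g1 x * u1 x) (fun x => g2 x * u2 x).

Let measurable_cos : measurable_fun setT (@cos R).
Proof. exact: continuous_measurable_fun (@continuous_cos R). Qed.

Let bcos1 v e : bmeas (cos1 v e).
Proof.
split; last by exists 1 => x; exact: cos_max.
by apply: measurableT_comp => //; exact: measurable_funD.
Qed.

Let bcos2 v e : bmeas (cos2 v e).
Proof.
split; last by exists 1 => x; exact: cos_max.
by apply: measurableT_comp => //; exact: measurable_funD.
Qed.

(** The only place where the equality of the one-dimensional laws is used: the mean of
    [cos (L v + e)] depends on the law of [L v] alone. *)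
Lemma same1 : same (cst 1) (cst 1).
Proof.
split; [exact: bmeas_cst|exact: bmeas_cst|move=> v e].
have mf : measurable_fun setT (fun y : R => (1 * cos (y + e))%:E).
  apply/measurable_EFinP; apply: measurable_funM => //.
  by apply: measurableT_comp => //; exact: measurable_funD.
have bf : bmeas (fun y : R => 1 * cos (y + e)).
  split; first exact/measurable_EFinP.
  by exists 1 => y; rewrite mul1r cos_max.
pose f y := (1 * cos (y + e))%:E.
have ->: mean P1 (fun x => cst 1 x * cos1 v e x) = (\int[pushforward P1 (L1 v)]_y f y)%E.
  rewrite integral_pushforward//.
  by apply: (@bmeas_integrable _ _ _ P1); apply: bmeasM; [exact: bmeas_cst|exact: bcos1].
have ->: mean P2 (fun x => cst 1 x * cos2 v e x) = (\int[pushforward P2 (L2 v)]_y f y)%E.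
  rewrite integral_pushforward//.
  by apply: (@bmeas_integrable _ _ _ P2); apply: bmeasM; [exact: bmeas_cst|exact: bcos2].
by apply: eq_measure_integral => A mA _; exact: L12.
Qed.

Lemma stable_cst c : stable (cst c) (cst c).
Proof.
move=> g1 g2 [b1 b2 g12]; split; [exact: bmeasM b1 (bmeas_cst _ _)|exact: bmeasM b2 (bmeas_cst _ _)|move=> v e].
transitivity (c%:E * mean P1 (fun x => (g1 x * cos1 v e x)%R))%E.
  by rewrite -meanZ; [congr mean; apply/funext => x; rewrite /cst; ring|exact: bmeasM].
rewrite g12 -meanZ; last exact: bmeasM.
by congr mean; apply/funext => x; rewrite /cst; ring.
Qed.

Lemma stableM u1 u2 w1 w2 : stable u1 u2 -> stable w1 w2 ->
  stable (fun x => u1 x * w1 x) (fun x => u2 x * w2 x).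
Proof.
move=> su sw g1 g2 sg; have := sw _ _ (su _ _ sg).
by under eq_fun do rewrite -mulrA; under [X in same _ X]eq_fun do rewrite -mulrA.
Qed.

Lemma stableD u1 u2 w1 w2 : stable u1 u2 -> stable w1 w2 ->
  stable (fun x => u1 x + w1 x) (fun x => u2 x + w2 x).
Proof.
move=> su sw g1 g2 sg; have [bu1 bu2 u12] := su _ _ sg; have [bw1 bw2 w12] := sw _ _ sg.
under eq_fun do rewrite mulrDr; under [X in same _ X]eq_fun do rewrite mulrDr.
split; [exact: bmeasD|exact: bmeasD|move=> v e].
under eq_fun do rewrite mulrDl; under [X in _ = mean _ X]eq_fun do rewrite mulrDl.
by rewrite !meanD ?u12 ?w12//; apply: bmeasM.
Qed.

Lemma stableX u1 u2 n : stable u1 u2 -> stable (fun x => u1 x ^+ n) (fun x => u2 x ^+ n).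
Proof.
move=> su; elim: n => [|n IH]; first exact: stable_cst.
have E (T : Type) (u : T -> R) : (fun x => u x ^+ n.+1) = (fun x => u x * u x ^+ n).
  by apply/funext => x; rewrite exprS.
by rewrite !E; exact: stableM.
Qed.

(** A product of two cosines is half a sum of cosines of [L (v + w)] and [L (v - w)], by linearity
    of the field in its index. *)
Lemma stable_cos v e : stable (cos1 v e) (cos2 v e).
Proof.
move=> g1 g2 [b1 b2 g12]; split; [exact: bmeasM|exact: bmeasM|move=> w f].
have E (g a b : R) : g * cos a * cos b = 2^-1 * (g * cos (a + b) + g * cos (a - b)).
  by rewrite cosD cosB; field.
have E1 x : g1 x * cos1 v e x * cos1 w f x = 2^-1 *
    (g1 x * cos1 (v + w) (e + f) x + g1 x * cos1 (v + (-1) *: w) (e - f) x).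
  by rewrite /cos1 E !L1D L1Z mulN1r opprD !addrA ![_ + _ + e]addrAC.
have E2 x : g2 x * cos2 v e x * cos2 w f x = 2^-1 *
    (g2 x * cos2 (v + w) (e + f) x + g2 x * cos2 (v + (-1) *: w) (e - f) x).
  by rewrite /cos2 E !L2D L2Z mulN1r opprD !addrA ![_ + _ + e]addrAC.
under eq_fun do rewrite E1; under [X in _ = mean _ X]eq_fun do rewrite E2.
rewrite !meanZ; [|by apply: bmeasD; exact: bmeasM|by apply: bmeasD; exact: bmeasM].
by rewrite !meanD ?g12//; apply: bmeasM.
Qed.

Lemma stable_lim (u1_ : nat -> T1 -> R) (u2_ : nat -> T2 -> R) u1 u2 M :
  (forall n, stable (u1_ n) (u2_ n)) ->
  (forall n x, `|u1_ n x| <= M) -> (forall n x, `|u2_ n x| <= M) ->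
  (forall x, u1_ n x @[n --> \oo] --> u1 x) ->
  (forall x, u2_ n x @[n --> \oo] --> u2 x) ->
  stable u1 u2.
Proof.
move=> su B1 B2 c1 c2 g1 g2 sg.
have [[m1 [M1 hM1]] [m2 [M2 hM2]] _] := sg.
have sn n := su n _ _ sg.
have lim1 v e : bmeas (fun x => g1 x * u1 x) /\ mean P1 (fun x => g1 x * u1_ n x * cos1 v e x)
    @[n --> \oo] --> mean P1 (fun x => g1 x * u1 x * cos1 v e x).
  split.
    have [|||bf _] := @mean_cvg _ _ _ P1 (fun n x => g1 x * u1_ n x) (fun x => g1 x * u1 x) (M1 * M).
    - by move=> n; case: (sn n) => -[].
    - by move=> n x; rewrite normrM ler_pM.
    - by move=> x; apply: cvgM; [exact: cvg_cst|exact: c1].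
    - exact: bf.
  have [|||_ cf] := @mean_cvg _ _ _ P1 (fun n x => g1 x * u1_ n x * cos1 v e x)
    (fun x => g1 x * u1 x * cos1 v e x) (M1 * M * 1).
  - by move=> n; apply: measurable_funM; [case: (sn n) => -[]|case: (bcos1 v e)].
  - by move=> n x; rewrite !normrM !ler_pM ?cos_max.
  - by move=> x; apply: cvgM; [apply: cvgM; [exact: cvg_cst|exact: c1]|exact: cvg_cst].
  - exact: cf.
have lim2 v e : bmeas (fun x => g2 x * u2 x) /\ mean P2 (fun x => g2 x * u2_ n x * cos2 v e x)
    @[n --> \oo] --> mean P2 (fun x => g2 x * u2 x * cos2 v e x).
  split.
    have [|||bf _] := @mean_cvg _ _ _ P2 (fun n x => g2 x * u2_ n x) (fun x => g2 x * u2 x) (M2 * M).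
    - by move=> n; case: (sn n) => _ -[].
    - by move=> n x; rewrite normrM ler_pM.
    - by move=> x; apply: cvgM; [exact: cvg_cst|exact: c2].
    - exact: bf.
  have [|||_ cf] := @mean_cvg _ _ _ P2 (fun n x => g2 x * u2_ n x * cos2 v e x)
    (fun x => g2 x * u2 x * cos2 v e x) (M2 * M * 1).
  - by move=> n; apply: measurable_funM; [case: (sn n) => _ -[]|case: (bcos2 v e)].
  - by move=> n x; rewrite !normrM !ler_pM ?cos_max.
  - by move=> x; apply: cvgM; [apply: cvgM; [exact: cvg_cst|exact: c2]|exact: cvg_cst].
  - exact: cf.
split; [exact: (lim1 0 0).1|exact: (lim2 0 0).1|move=> v e].
apply: (cvg_unique _ (lim1 v e).2) => //.
have E : (fun n => mean P1 (fun x => g1 x * u1_ n x * cos1 v e x)) =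
         (fun n => mean P2 (fun x => g2 x * u2_ n x * cos2 v e x)).
  by apply/funext => n; have [_ _ ->] := sn n.
by rewrite E; exact: (lim2 v e).2.
Qed.


Definition sset (B1 : set T1) (B2 : set T2) := stable (\1_B1 : T1 -> R) (\1_B2 : T2 -> R).

(** Two successive limits. The affine image [w] of a slow sine has values in [0, 1] and exceeds 1/2
    where the sine is nonnegative, so the threshold polynomials produce the indicator of that set;
    slowing the sine down turns it into the half-line. *)
Lemma sset_ge v a : sset [set x | a <= L1 v x] [set x | a <= L2 v x].
Proof.
pose w (x : R) k := (1 + sin ((x - a) / k.+1%:R)) / 2.
have sw k : stable (fun x => w (L1 v x) k) (fun x => w (L2 v x) k).
  have E1 x : w (L1 v x) k = (1 + cos1 (k.+1%:R^-1 *: v) (- a / k.+1%:R - pi / 2) x) * 2^-1.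
    by rewrite /w /cos1 L1Z addrA cosBpihalf; congr ((1 + sin _) / 2); ring.
  have E2 x : w (L2 v x) k = (1 + cos2 (k.+1%:R^-1 *: v) (- a / k.+1%:R - pi / 2) x) * 2^-1.
    by rewrite /w /cos2 L2Z addrA cosBpihalf; congr ((1 + sin _) / 2); ring.
  rewrite (funext E1) (funext E2).
  apply: (stableM _ (stable_cst 2^-1)); apply: (stableD (stable_cst 1)); exact: stable_cos.
have w01 x k : 0 <= w x k <= 1.
  by have := sin_le1 ((x - a) / k.+1%:R); have := sin_geN1 ((x - a) / k.+1%:R); rewrite /w; lra.
have pl (y : R) n : 0 <= y <= 1 -> `|1 - (1 - y ^+ n) ^+ (n * 2 ^ n)| <= 1.
  move=> /andP[y0 y1].
  have /andP[z0 z1] : 0 <= 1 - y ^+ n <= 1.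
    by rewrite subr_ge0 exprn_ile1//= lerBlDr lerDl exprn_ge0.
  have Z0 : 0 <= (1 - y ^+ n) ^+ (n * 2 ^ n) by rewrite exprn_ge0.
  have Z1 : (1 - y ^+ n) ^+ (n * 2 ^ n) <= 1 by rewrite exprn_ile1.
  by rewrite ger0_norm; lra.
have shalf k : stable (fun x => (2^-1 <= w (L1 v x) k)%R%:R) (fun x => (2^-1 <= w (L2 v x) k)%R%:R).
  apply: (@stable_lim (fun n x => 1 - (1 - w (L1 v x) k ^+ n) ^+ (n * 2 ^ n))
    (fun n x => 1 - (1 - w (L2 v x) k ^+ n) ^+ (n * 2 ^ n)) _ _ 1).
  - have sN u1 u2 : stable u1 u2 -> stable (fun x => 1 - u1 x) (fun x => 1 - u2 x).
      move=> su; apply: (stableD (stable_cst 1)).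
      have E (T : Type) (u : T -> R) : (fun x => - u x) = (fun x => (-1) * u x).
        by apply/funext => x; rewrite mulN1r.
      by rewrite !E; exact: (stableM (stable_cst (-1))).
    by move=> n; apply/sN/stableX/sN/stableX.
  - by move=> n x; exact: pl.
  - by move=> n x; exact: pl.
  - by move=> x; exact: cvg_threshold.
  - by move=> x; exact: cvg_threshold.
have half x k : (2^-1 <= w x k) = (0 <= sin ((x - a) / k.+1%:R)).
  by apply/idP/idP; rewrite /w => ?; lra.
apply: (stable_lim shalf (M := 1)).
- by move=> n x; rewrite normr_nat lern1 leq_b1.
- by move=> n x; rewrite normr_nat lern1 leq_b1.
- move=> x; under eq_fun do rewrite half.
  rewrite indicE (_ : (_ \in _) = (0 <= L1 v x - a)); first exact: cvg_sin_sign.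
  by rewrite subr_ge0; apply/idP/idP; rewrite inE.
- move=> x; under eq_fun do rewrite half.
  rewrite indicE (_ : (_ \in _) = (0 <= L2 v x - a)); first exact: cvg_sin_sign.
  by rewrite subr_ge0; apply/idP/idP; rewrite inE.
Qed.

Lemma sset_setC B1 B2 : sset B1 B2 -> sset (~` B1) (~` B2).
Proof.
move=> sB; rewrite /sset.
have E (T : Type) (B : set T) : \1_(~` B) = (fun x => 1 + (-1) * \1_B x) :> (T -> R).
  by apply/funext => x; rewrite !indicE in_setC; case: (x \in B) => /=; ring.
rewrite !E; exact: (stableD (stable_cst 1) (stableM (stable_cst (-1)) _)).
Qed.

Lemma sset_forall (I : finType) (F1 : I -> set T1) (F2 : I -> set T2) :
  (forall i, sset (F1 i) (F2 i)) ->
  sset [set x | forall i, F1 i x] [set x | forall i, F2 i x].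
Proof.
move=> sF; rewrite /sset.
have E (T : Type) (F : I -> set T) :
    \1_[set x | forall i, F i x] = (fun x => \prod_i \1_(F i) x) :> (T -> R).
  apply/funext => x; rewrite indicE; have [Fx|/existsNP[i Fi]] := EM (forall i, F i x).
    by rewrite mem_set// big1// => i _; rewrite indicE mem_set.
  by rewrite memNset; [rewrite (bigD1 i)//= indicE memNset// mul0r|exact].
rewrite !E; elim: (index_enum I) => [|i r IH].
  have E0 (T : Type) (F : I -> set T) : (fun x => \prod_(i <- [::]) \1_(F i) x) = cst 1 :> (T -> R).
    by apply/funext => x; rewrite big_nil.
  by rewrite !E0; exact: stable_cst.
have Ec (T : Type) (F : I -> set T) : (fun x => \prod_(j <- i :: r) \1_(F j) x) =
    (fun x => \1_(F i) x * \prod_(j <- r) \1_(F j) x) :> (T -> R).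
  by apply/funext => x; rewrite big_cons.
by rewrite !Ec; apply: stableM => //; exact: sF.
Qed.

(** The indicator of the complement of the union is the limit of finite products of indicators of
    complements. *)
Lemma sset_bigcup (F1 : nat -> set T1) (F2 : nat -> set T2) :
  (forall n, sset (F1 n) (F2 n)) -> sset (\bigcup_n F1 n) (\bigcup_n F2 n).
Proof.
move=> sF; rewrite -[X in sset X _]setCK -[X in sset _ X]setCK; apply: sset_setC.
pose u (T : Type) (F : nat -> set T) n x : R := \prod_(i < n) \1_(~` F i) x.
have u01 (T : Type) (F : nat -> set T) n x : `|u T F n x| <= 1.
  rewrite normr_prod prodr_ile1// => i _; rewrite normr_ge0/= indicE.
  by case: (_ \in _); rewrite ?normr1 ?normr0.
have uc (T : Type) (F : nat -> set T) x : u T F n x @[n --> \oo] --> (\1_(~` \bigcup_n F n) x : R).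
  apply: cvg_near_cst; have [[i _ Fi]|nF] := EM ((\bigcup_n F n) x).
    near=> n; have ni : (i < n)%N by near: n; exact: nbhs_infty_gt.
    rewrite /u (bigD1 (Ordinal ni))//= !indicE memNset; last by apply.
    by rewrite mul0r memNset//; apply; exists i.
  near=> n; rewrite indicE mem_set// /u big1// => i _.
  by rewrite indicE mem_set// => Fi; apply: nF; exists i.
apply: (@stable_lim (u T1 F1) (u T2 F2) _ _ 1) => [n|n x|n x|x|x]; [|exact: u01|exact: u01|exact: uc|exact: uc].
elim: n => [|n IH].
  have E (T : Type) (F : nat -> set T) : u T F 0 = cst 1 by apply/funext => x; rewrite /u big_ord0.
  by rewrite !E; exact: stable_cst.
have E (T : Type) (F : nat -> set T) : u T F n.+1 = (fun x => u T F n x * \1_(~` F n) x).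
  by apply/funext => x; rewrite /u big_ord_recr.
by rewrite !E; apply: stableM => //; apply: sset_setC.
Unshelve. all: by end_near. Qed.

(** Stability is tested on the constant 1 and on the cosine with index 0 and phase 0, which is also
    1. *)
Lemma sset_prob B1 B2 : measurable B1 -> measurable B2 -> sset B1 B2 -> P1 B1 = P2 B2.
Proof.
move=> mB1 mB2 sB; have [_ _ /(_ 0 0)] := sB _ _ same1.
have L10 x : L1 0 x = 0 by rewrite -(scale0r 0) L1Z mul0r.
have L20 x : L2 0 x = 0 by rewrite -(scale0r 0) L2Z mul0r.
rewrite /mean /cos1 /cos2.
under eq_integral do rewrite L10 addr0 cos0 mulr1 mul1r.
under [in RHS]eq_integral do rewrite L20 addr0 cos0 mulr1 mul1r.
by rewrite !integral_indic// !setIT.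
Qed.

Lemma sset_preimage v (B : set R) : measurable B -> sset (L1 v @^-1` B) (L2 v @^-1` B).
Proof.
move=> mB; have {mB} : <<s @RGenCInfty.G R >> B.
  by have := @RGenCInfty.measurableE R; rewrite /measurable /= => <-.
move: B; apply: smallest_sub; last first.
  move=> _ [a ->].
  have E (T : Type) (L : T -> R) : L @^-1` `[a, +oo[%classic = [set x | a <= L x].
    by apply/seteqP; split => x /=; rewrite in_itv /= andbT.
  by rewrite /= !E; exact: sset_ge.
have E0 (T : Type) : \1_set0 = cst 0 :> (T -> R) by apply/funext => x; rewrite indicE in_set0.
split.
- by rewrite /sset /= !preimage_set0 !E0; exact: stable_cst.
- by move=> B sB /=; rewrite !setTD; exact: sset_setC.
- by move=> F sF /=; rewrite !preimage_bigcup; exact: sset_bigcup.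
Qed.

End identically_distributed_fields.

(** * The Borel sigma-algebra of a Hilbert space *)

Section borel_measurability.
Context {R : realType}.
Implicit Types H : hilbertType R.

Lemma separable_seq H : separable H ->
  exists x : nat -> H, forall y e, 0 < e -> exists n, ball y e (x n).
Proof.
move=> [D /countable_injP[f finj] dD].
exists (fun n => xget 0 [set x | D x /\ f x = n]) => y e e0.
have [||x [yx Dx]] := dD (ball y e); first by exists y; exact: ballxx.
  exact: ball_open.
exists (f x); have [|Dz fz] := @xgetPex _ 0 [set z | D z /\ f z = f x]; first by exists x.
by rewrite (finj _ _ _ _ fz) ?inE.
Qed.

Lemma measurable_continuous (U : ptopologicalType) (f : U -> R) :
  continuous f -> measurable_fun [set: borel U] (f : borel U -> R).
Proof.
move=> cf; apply: (measurability _ (RGenOpens.measurableE R)) => _ [_ [a [b ->]] <-].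
by rewrite setTI; apply: sub_sigma_algebra; apply: open_comp => // x _; exact: cf.
Qed.

Section weak.
Variable H : hilbertType R.
Hypotheses (sH : separable H) (oH : orthonormal_basis (onb H)).
Context d (T : measurableType d).
Implicit Types f g : T -> borel H.

Definition weakly_measurable (f : T -> H) :=
  forall h, measurable_fun setT (fun x => inner h (f x)).

Lemma weakly_measurable_norm (f : T -> H) : weakly_measurable f ->
  measurable_fun setT (fun x => `|f x| ^+ 2).
Proof.
move=> wf; pose u n x : R := \sum_(i < n) inner (f x) (onb H i) ^+ 2.
have mu n : measurable_fun setT (u n).
  apply: measurable_sum => i; apply: measurable_funX.
  by under eq_fun do rewrite innerC; exact: wf.
apply: (measurable_fun_cvg mu) => x _.
exact: parseval_cvg.
Qed.

Lemma weakly_measurable_ball (f : T -> H) c r : weakly_measurable f ->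
  measurable (f @^-1` ball c r).
Proof.
move=> wf; have [r0|r0] := leP r 0.
  rewrite (_ : _ @^-1` _ = set0)//; apply/seteqP; split => x //=.
  by rewrite -ball_normE /ball_ /= => h; have := lt_le_trans h r0; rewrite normr_lt0.
have wfc : weakly_measurable (fun x => f x - c).
  move=> h; under eq_fun do rewrite innerBr.
  by apply: measurable_funB.
have := weakly_measurable_norm wfc measurableT (measurable_itv `]-oo, r ^+ 2[).
rewrite setTI; congr measurable; apply/seteqP; split => x /=;
  rewrite in_itv /= ltr_sqr ?nnegrE ?(ltW r0)// distrC; by rewrite -ball_normE.
Qed.

(** Pettis: in a separable space an open set is a countable union of balls, and preimages of balls
    are measurable because the norm is a limit of finite sums of squared coordinates. *)
Lemma weakly_measurableP (f : T -> H) : weakly_measurable f ->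
  measurable_fun setT (f : T -> borel H).
Proof.
move=> wf; have [z zd] := separable_seq sH.
apply: (@measurability _ _ _ (borel H) _ _ (@open H)) => // _ [U oU <-]; rewrite setTI.
pose B n k := [set x | ball (z n) k.+1%:R^-1 `<=` U /\ ball (z n) k.+1%:R^-1 (f x)].
rewrite (_ : f @^-1` U = \bigcup_n \bigcup_k B n k).
  apply: bigcup_measurable => n _; apply: bigcup_measurable => k _.
  have [h|h] := EM (ball (z n) k.+1%:R^-1 `<=` U).
    rewrite (_ : B n k = f @^-1` ball (z n) k.+1%:R^-1); first exact: weakly_measurable_ball.
    by apply/seteqP; split => x //= [].
  by rewrite (_ : B n k = set0)//; apply/seteqP; split => x //= [].
apply/seteqP; split => [x /= Ux|x [n _ [k _ [sub fx]]]]; last exact: sub.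
have /nbhs_ballP[e /= e0 eU] := open_nbhs_nbhs (conj oU Ux).
(* The radius is below e/2, so a ball of this radius that contains [f x] stays inside the ball of
   radius [e] around [f x]. *)
have [k _ ke] := near_infty_natSinv_lt (PosNum (divr_gt0 e0 (ltr0n R 2))).
have k0 : 0 < k.+1%:R^-1 :> R by rewrite invr_gt0.
have [n xn] := zd (f x) _ k0.
exists n => //; exists k => //; split; last exact: ball_sym.
move=> y zy; apply: eU; apply: le_ball (ball_triangle xn zy).
by have := ke k (leqnn k); rewrite /= ltr_pdivlMr// mulr_natr mulr2n => /ltW.
Qed.

End weak.

Section product.
Variables H1 H2 : hilbertType R.
Hypotheses (sH1 : separable H1) (sH2 : separable H2).

Lemma measurable_borel_fst :
  measurable_fun [set: borel (H1 * H2)%type] (fst : borel (H1 * H2)%type -> borel H1).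
Proof.
apply: (@measurability _ _ _ (borel H1) _ _ (@open H1)) => // _ [B oB <-].
by rewrite setTI; apply: sub_sigma_algebra; apply: open_comp => // x _; exact: cvg_fst.
Qed.

Lemma measurable_borel_snd :
  measurable_fun [set: borel (H1 * H2)%type] (snd : borel (H1 * H2)%type -> borel H2).
Proof.
apply: (@measurability _ _ _ (borel H2) _ _ (@open H2)) => // _ [B oB <-].
by rewrite setTI; apply: sub_sigma_algebra; apply: open_comp => // x _; exact: cvg_snd.
Qed.

(** Couplings live on the Borel sets of the product space, not on the product sigma-algebra.
    Separability reconciles the two: every open set is a countable union of products of balls. *)
Lemma measurable_borel_pair d (T : measurableType d) (f : T -> borel H1) (g : T -> borel H2) :
  measurable_fun setT f -> measurable_fun setT g ->
  measurable_fun setT ((fun x => (f x, g x)) : T -> borel (H1 * H2)%type).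
Proof.
move=> mf mg; have [y yd] := separable_seq sH1; have [z zd] := separable_seq sH2.
apply: (@measurability _ _ _ (borel (H1 * H2)%type) _ _ (@open (H1 * H2)%type)) => // _ [U oU <-].
rewrite setTI.
pose C n m k := [set u : H1 * H2 | ball (y n) k.+1%:R^-1 u.1 /\ ball (z m) k.+1%:R^-1 u.2].
pose B n m k := [set x | C n m k `<=` U /\ C n m k (f x, g x)].
rewrite (_ : _ @^-1` U = \bigcup_n \bigcup_m \bigcup_k B n m k).
  apply: bigcup_measurable => n _; apply: bigcup_measurable => m _.
  apply: bigcup_measurable => k _.
  have [h|h] := EM (C n m k `<=` U); last first.
    by rewrite (_ : B n m k = set0)//; apply/seteqP; split => x //= [].
  rewrite (_ : B n m k = f @^-1` ball (y n : H1) k.+1%:R^-1 `&` g @^-1` ball (z m : H2) k.+1%:R^-1).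
    apply: measurableI; rewrite -[X in measurable X]setTI; [apply: mf|apply: mg] => //;
      by apply: sub_sigma_algebra; exact: ball_open.
  by apply/seteqP; split => x //= [].
apply/seteqP; split => [x /= Ux|x [n _ [m _ [k _ [sub fx]]]]]; last exact: sub.
have /nbhs_ballP[e /= e0 eU] := open_nbhs_nbhs (conj oU Ux).
have [k _ ke] := near_infty_natSinv_lt (PosNum (divr_gt0 e0 (ltr0n R 2))).
have k0 : 0 < k.+1%:R^-1 :> R by rewrite invr_gt0.
have k2 : k.+1%:R^-1 + k.+1%:R^-1 <= e.
  by have := ke k (leqnn k); rewrite /= ltr_pdivlMr// mulr_natr mulr2n => /ltW.
have [n xn] := yd (f x) _ k0; have [m xm] := zd (g x) _ k0.
exists n => //; exists m => //; exists k => //; split; last by split; exact: ball_sym.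
move=> [u v] [/= yu zv]; apply: eU; split => /=.
  exact: le_ball k2 _ (ball_triangle xn yu).
exact: le_ball k2 _ (ball_triangle xm zv).
Qed.

End product.

End borel_measurability.

(** * Uniqueness of laws from their marginals, and small-ball probabilities *)

Section gaussian_measures.
Context {R : realType} (H : hilbertType R).
Hypotheses (sH : separable H) (oH : orthonormal_basis (onb H)).
Local Notation N1 := (@normal_prob R 0 1).

Lemma measurable_inner (h : H) : measurable_fun [set: borel H] (inner h : borel H -> R).
Proof. exact: (measurable_continuous (@continuous_inner R H h)). Qed.

(** Half-spaces generate the Borel sets: for the sigma-algebra [S] on the domain, the identity is
    weakly measurable, hence Borel measurable. *)
Lemma borel_ind (S : set (set H)) : sigma_algebra setT S ->
  (forall h a, S [set x | a <= inner h x]) ->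
  forall B : set (borel H), measurable B -> S B.
Proof.
move=> sS hS B mB; pose T := g_sigma_algebraType S.
have SE : @measurable _ T = S by exact: measurable_g_measurableTypeE.
have w : weakly_measurable (id : T -> H).
  move=> h; apply: (measurability _ (RGenCInfty.measurableE R)) => _ [_ [a ->] <-].
  rewrite setTI SE (_ : _ @^-1` _ = [set x | a <= inner h x])//.
  by apply/seteqP; split => x /=; rewrite in_itv /= andbT.
by have := weakly_measurableP sH oH w measurableT mB; rewrite setTI SE.
Qed.

(** The sets whose indicator is stable form a sigma-algebra that contains the half-spaces. *)
Lemma gaussian_unique (mu nu : probability (borel H) R) :
  (forall h (B : set R), measurable B -> mu (inner h @^-1` B) = nu (inner h @^-1` B)) ->
  forall B : set (borel H), measurable B -> mu B = nu B.
Proof.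
move=> mn B mB.
pose L (h : H) : borel H -> R := inner h.
have mL h : measurable_fun setT (L h) by exact: measurable_inner.
have LD u v x : L (u + v) x = L u x + L v x by exact: innerDl.
have LZ a v x : L (a *: v) x = a * L v x by exact: innerZl.
apply: (@sset_prob _ _ _ _ _ _ mu nu L L) => //.
move: B mB; apply: borel_ind => [|h a]; last exact: sset_ge.
split.
- have E : \1_(set0 : set (borel H)) = cst 0 :> (borel H -> R).
    by apply/funext => x; rewrite indicE in_set0.
  by rewrite /sset E; exact: stable_cst.
- by move=> A sA; rewrite setTD; exact: sset_setC.
- by move=> F sF; exact: sset_bigcup.
Qed.

Lemma N1_ball (t : R) : 0 <= t -> (N1 [set x | (`|x| < t)%R] <= (2 * t)%:E)%E.
Proof.
move=> t0; rewrite (_ : [set x | _] = `](- t), t[%classic); last first.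
  by apply/seteqP; split => x /=; rewrite in_itv /= ltr_norml.
rewrite /normal_prob.
have key : (\int[@lebesgue_measure R]_(x in `](- t)%R, t[) (normal_pdf 0 1 x)%:E <=
    \int[@lebesgue_measure R]_(x in `](- t)%R, t[) (normal_peak 1)%:E)%E.
  apply: ge0_le_integral => //.
  - by move=> x _; rewrite lee_fin normal_pdf_ge0.
  - by apply: measurable_funTS; apply/measurable_EFinP; exact: measurable_normal_pdf.
  - by move=> x _; rewrite lee_fin normal_pdf_ub// oner_neq0.
apply: (le_trans key).
rewrite integral_cst//= lebesgue_measure_itv/=; case: ifPn => _; last first.
  by rewrite mule0 lee_fin mulr_ge0.
have pk1 : normal_peak (1 : R) <= 1.
  rewrite /normal_peak invf_le1 ?sqrtr_gt0; last first.
    by rewrite expr1n mul1r mulrn_wgt0// pi_gt0.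
  rewrite -[leLHS]sqrtr1 expr1n mul1r mulr2n.
  by have := pi_ge2 R => pi2; rewrite ler_sqrt; lra.
rewrite -EFinD -EFinM lee_fin opprK.
by have := normal_peak_ge0 (1 : R); nra.
Qed.

Lemma measurable_itv_norm (t : R) : measurable [set x : R | `|x| < t].
Proof.
rewrite (_ : [set x | _] = `](- t), t[%classic)//.
by apply/seteqP; split => x /=; rewrite in_itv /= ltr_norml.
Qed.

Lemma measurable_forall d (T : measurableType d) (I : finType) (F : I -> set T) :
  (forall i, measurable (F i)) -> measurable [set x | forall i, F i x].
Proof.
move=> mF; rewrite (_ : [set x | _] = \bigcap_(i in setT) F i); first exact: fin_bigcap_measurable.
by apply/seteqP; split => x /=; [move=> h i _; exact: h|move=> h i; exact: h].
Qed.

Let box n (t : R) := [set z : n.-tuple (measurableTypeR R) | forall i, `|tnth z i| < t].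

Let measurable_box n (t : R) : measurable (@box n t).
Proof.
suff mi (i : 'I_n) : measurable [set z : n.-tuple (measurableTypeR R) | `|tnth z i| < t].
  exact: measurable_forall mi.
rewrite -[X in measurable X]setTI.
exact: (@measurable_tnth _ _ _ i measurableT _ (measurable_itv_norm t)).
Qed.

Lemma power_N1_box n (t : R) : 0 <= t ->
  (power_prob N1 n (@box n t) <= ((2 * t) ^+ n)%:E)%E.
Proof.
move=> t0; elim: n => [|n IH].
  apply: le_trans (probability_le1 _ _) _; last by rewrite expr0.
  rewrite (_ : @box 0 t = setT)//; apply/seteqP; split => // z _ [] //.
rewrite /= /distribution /pushforward.
have -> : @tuple_cons _ _ n @^-1` @box n.+1 t =
    [set x : measurableTypeR R | (`|x| < t)%R] `*` @box n t.
  apply/seteqP; split => [[x z] /= h|[x z] /= [hx hz] i].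
    by split => [|i]; [have := h ord0|have := h (lift ord0 i); rewrite tnth_tuple_cons].
  by have [j ->|->] := unliftP ord0 i; rewrite ?tnth_tuple_cons.
rewrite product_measure1E//; last exact: measurable_box; last first.
  exact: measurable_itv_norm.
by rewrite exprS EFinM lee_pmul// N1_ball.
Qed.

(** The hypothesis on the [q i] makes them jointly standard normal under [mu]. Their combinations
    and those of independent normal coordinates have the same one-dimensional laws, so the two boxes
    have the same probability. *)
Lemma gaussian_small_ball (mu : probability (borel H) R) (T : H -> H) n (q : 'I_n -> H) (t : R) :
  0 <= t -> gaussian mu T ->
  (forall c : 'I_n -> R, inner (T (\sum_i c i *: q i)) (\sum_i c i *: q i) = \sum_i c i ^+ 2) ->
  (mu [set y : borel H | forall i, `|inner (q i) y| < t]%R <= ((2 * t) ^+ n)%:E)%E.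
Proof.
move=> t0 gmu hq; apply: le_trans (power_N1_box n t0).
pose L1 (c : 'rV[R]_n) (y : borel H) : R := inner (\sum_i c 0 i *: q i) y.
pose L2 (c : 'rV[R]_n) (z : n.-tuple (measurableTypeR R)) : R := \sum_i c 0 i * tnth z i.
have mL1 c : measurable_fun setT (L1 c) by exact: measurable_inner.
have mL2 c : measurable_fun setT (L2 c).
  by apply: measurable_sum => i; apply: measurable_funM => //; exact: measurable_tnth.
have L1D u v y : L1 (u + v) y = L1 u y + L1 v y.
  by rewrite /L1 -innerDl -big_split /=; under eq_bigr do rewrite mxE scalerDl.
have L2D u v y : L2 (u + v) y = L2 u y + L2 v y.
  by rewrite /L2 -big_split /=; under eq_bigr do rewrite mxE mulrDl.
have L1Z a v y : L1 (a *: v) y = a * L1 v y.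
  by rewrite /L1 -innerZl scaler_sumr; under eq_bigr do rewrite mxE -scalerA.
have L2Z a v y : L2 (a *: v) y = a * L2 v y.
  by rewrite /L2 mulr_sumr; under eq_bigr do rewrite mxE -mulrA.
have L12 v B : measurable B -> mu (L1 v @^-1` B) = power_prob N1 n (L2 v @^-1` B).
  by move=> mB; rewrite gmu// hq (normal_law_power (fun i => v 0 i)).
pose e i : 'rV[R]_n := delta_mx 0 i.
have L1e i y : L1 (e i) y = inner (q i) y.
  rewrite /L1 (bigD1 i)//= big1 ?addr0 => [|j ji]; first by rewrite mxE !eqxx scale1r.
  by rewrite mxE (negbTE ji) andbF scale0r.
have L2e i y : L2 (e i) y = tnth y i.
  rewrite /L2 (bigD1 i)//= big1 ?addr0 => [|j ji]; first by rewrite mxE !eqxx mul1r.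
  by rewrite mxE (negbTE ji) andbF mul0r.
pose I : set R := [set x | `|x| < t].
rewrite (_ : [set y | _] = [set y | forall i, (L1 (e i) @^-1` I) y]); last first.
  by apply/seteqP; split => y /= h i; have := h i; rewrite /I /= L1e.
rewrite (_ : @box n t = [set z | forall i, (L2 (e i) @^-1` I) z]); last first.
  by apply/seteqP; split => y /= h i; have := h i; rewrite /I /= L2e.
suff E : mu [set y | forall i, (L1 (e i) @^-1` I) y] =
    power_prob N1 n [set z | forall i, (L2 (e i) @^-1` I) z] by rewrite E.
apply: (@sset_prob _ _ _ _ _ _ mu (power_prob N1 n) L1 L2) => //.
- apply: measurable_forall => i; rewrite -[X in measurable X]setTI.
  by apply: mL1 => //; exact: measurable_itv_norm.
- apply: measurable_forall => i; rewrite -[X in measurable X]setTI.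
  by apply: mL2 => //; exact: measurable_itv_norm.
- apply: sset_forall => // i; apply: sset_preimage => //; exact: measurable_itv_norm.
Qed.

End gaussian_measures.

(** * Perturbation of projectors *)

Section projectors.
Context {R : realType} (H : hilbertType R).
Local Notation "<[ x , y ]>" := (inner x y).

Lemma qm_opD r (Y : quasimatrix H r) a (c e : 'cV[R]_r) :
  qm_op Y (a *: c + e) = a *: qm_op Y c + qm_op Y e.
Proof.
rewrite /qm_op scaler_sumr -big_split; apply: eq_bigr => i _.
by rewrite !mxE scalerDl scalerA.
Qed.

Lemma qm_op_delta r (Y : quasimatrix H r) i : qm_op Y (delta_mx i 0) = Y i.
Proof.
rewrite /qm_op (bigD1 i)//= big1 ?addr0 => [|j ji]; first by rewrite mxE !eqxx scale1r.
by rewrite mxE (negbTE ji) scale0r.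
Qed.

(** Gram--Schmidt inside the range of [Y] gives an explicit projector; the defining property of
    [orthoproj] has only one solution, so the two agree. *)
Lemma qm_projP r (Y : quasimatrix H r) : exists q, [/\ oseq q,
  (forall x, qm_proj Y x = oproj q x), (forall c, oproj q (qm_op Y c) = qm_op Y c) &
  (forall x, exists c, oproj q x = qm_op Y c)].
Proof.
pose S := range (qm_op Y).
have S0 : S 0 by exists 0 => //; rewrite /qm_op big1// => i _; rewrite mxE scale0r.
have Slin a x y : S x -> S y -> S (a *: x + y).
  by move=> [c _ <-] [e _ <-]; exists (a *: c + e) => //; rewrite qm_opD.
have SY x : x \in map Y (index_enum 'I_r) -> S x.
  by move=> /mapP[i _ ->]; exists (delta_mx i 0) => //; exact: qm_op_delta.
have [//|q []] := @oseq_extend_in R H S [::] _ Slin S0 _ SY I.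
rewrite cats0 => oq qY Sq.
have qE c : oproj q (qm_op Y c) = qm_op Y c.
  rewrite oproj_sum; apply: eq_bigr => i _.
  by rewrite oprojZ qY//; apply/mapP; exists i => //; rewrite mem_index_enum.
exists q; split => // x; last by have [c _ <-] := oproj_in x Slin S0 Sq; exists c.
have [|[c _ yE] yS] := @xgetPex _ 0 [set y | S y /\ forall z, S z -> <[x - y, z]> = 0].
  exists (oproj q x); split; first exact: oproj_in.
  by move=> _ [c _ <-]; rewrite -qE oproj_orth.
rewrite /qm_proj /orthoproj -/S; move: yE yS; set y := xget _ _ => yE yS.
have Sd : S (oproj q x - y).
  by rewrite addrC -scaleN1r; apply: (Slin); [exists c|exact: oproj_in].
apply/esym/subr0_eq/eqP; rewrite -normr_eq0 -sqrf_eq0 -inner_normE; apply/eqP.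
have E : oproj q x - y = x - y - (x - oproj q x) by rewrite opprB [RHS]addrC subrKA.
rewrite {1}E innerBl yS// sub0r; have [d _ <-] := Sd.
by rewrite -qE oproj_orth// oppr0.
Qed.

(** With Pf and Pg the two projectors, Pf - Pg = Pf (1 - Pg) - (1 - Pf) Pg, and each term is
    controlled by the relative perturbation of [Y]. *)
Lemma oproj_perturbation r (Y X : quasimatrix H r) f g eta : oseq f -> oseq g ->
  (forall c, oproj f (qm_op Y c) = qm_op Y c) -> (forall x, exists c, oproj f x = qm_op Y c) ->
  (forall c, oproj g (qm_op X c) = qm_op X c) -> (forall x, exists c, oproj g x = qm_op X c) ->
  0 <= eta -> (forall c, `|qm_op X c - qm_op Y c| <= eta * `|qm_op Y c|) ->
  forall x, `|oproj f x - oproj g x| <= 4 * eta * `|x|.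
Proof.
move=> of_ og fY fC gX gC eta0 XY x.
(* Two projectors always differ by at most 2, which settles [eta >= 1/2] and is what requires the
   factor 4. *)
have [eta_ge|eta_lt] := leP 2^-1 eta.
  apply: le_trans (ler_normB _ _) _.
  have := norm_oproj_le x of_; have := norm_oproj_le x og; have := normr_ge0 x; nra.
(* |(1 - Pg) Pf| <= eta, hence |Pf (1 - Pg)| <= eta by duality *)
have h1 y : `|oproj f y - oproj g (oproj f y)| <= eta * `|y|.
  have [c cE] := fC y; apply: (@le_trans _ _ (eta * `|oproj f y|)); last first.
    by rewrite ler_wpM2l// norm_oproj_le.
  by rewrite cE (le_trans (best_approx _ og (gX c)))// distrC XY.
have h2 : `|oproj f (x - oproj g x)| <= eta * `|x|.
  set z := x - oproj g x; set p := oproj f z.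
  have zx : `|z| <= `|x| by exact: norm_residual_le.
  have [->|p0] := eqVneq p 0; first by rewrite normr0 mulr_ge0.
  have pp : 0 < `|p| by rewrite normr_gt0.
  have : `|p| ^+ 2 <= eta * `|p| * `|x|.
    have -> : `|p| ^+ 2 = <[p - oproj g p, z]>.
      rewrite -inner_normE {1}/p -oproj_sym {1}/p oproj_idem// -/p.
      by rewrite innerBl oproj_sym /z oprojB oproj_idem// subrr inner0r subr0 innerC.
    apply: le_trans (inner_le _ _) _; rewrite ler_pM//.
    by have := h1 p; rewrite /p oproj_idem.
  by rewrite expr2 mulrAC ler_pM2r.
have h3 : `|oproj g x - oproj f (oproj g x)| <= 2 * eta * `|x|.
  have [c cE] := gC x; rewrite cE.
  apply: (@le_trans _ _ (eta * `|qm_op Y c|)).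
    by rewrite (le_trans (best_approx _ of_ (fY c))).
  (* For [eta < 1/2] the perturbation keeps at least half of the norm, which turns the bound
     relative to [Y] into one relative to [X]. *)
  have : `|qm_op Y c| <= 2 * `|qm_op X c|.
    have := XY c; have : `|qm_op Y c| <= `|qm_op X c - qm_op Y c| + `|qm_op X c|.
      by rewrite distrC -{1}(subrK (qm_op X c) (qm_op Y c)) ler_normD.
    by have := normr_ge0 (qm_op Y c); nra.
  have := norm_oproj_le x og; rewrite cE; nra.
have -> : oproj f x - oproj g x = oproj f (x - oproj g x) - (oproj g x - oproj f (oproj g x)).
  by rewrite oprojB opprB addrA subrK.
apply: le_trans (ler_normB _ _) _; have := normr_ge0 x; nra.
Qed.

End projectors.

Lemma lee_sqr_sqrte (R : realType) (x : \bar R) (r : R) : (0 <= x)%E -> 0 <= r ->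
  (sqrte x <= r%:E)%E = (x <= (r ^+ 2)%:E)%E.
Proof.
move=> x0 r0; rewrite -[RHS]lee_sqrt; last by rewrite lee_fin sqr_ge0.
by rewrite /= sqrtr_sqr ger0_norm.
Qed.

(** * Deterministic bound on the error of the randomized SVD *)

Section error_bound.
Context {R : realType} (H1 H2 : hilbertType R).
Hypotheses (o1 : orthonormal_basis (onb H1)) (o2 : orthonormal_basis (onb H2)).
Variable A : {linear H1 -> H2}.
Hypothesis hsA : hilbert_schmidt A.
Local Notation "<[ x , y ]>" := (inner x y).

Lemma hs_normE (K1 K2 : hilbertType R) (B : K1 -> K2) : hs_norm B = sqrte (hs2 B).
Proof. by []. Qed.

Lemma adjointD a x y : adjoint A (a *: x + y) = a *: adjoint A x + adjoint A y.
Proof.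
apply: inner_allE => z; rewrite innerC -(adjointP o1 z _ hsA) innerDr innerZr.
by rewrite !(adjointP o1 _ _ hsA) innerDl innerZl !(innerC z).
Qed.

Lemma adjoint_sum n (c : 'I_n -> R) (x : 'I_n -> H2) :
  adjoint A (\sum_i c i *: x i) = \sum_i c i *: adjoint A (x i).
Proof.
apply: inner_allE => z; rewrite innerC -(adjointP o1 z _ hsA) inner_sumr inner_suml.
by apply: eq_bigr => i _; rewrite innerZr innerZl (adjointP o1 _ _ hsA) (innerC z).
Qed.

Section discretization.
Variables (m n : nat) (Z : quasimatrix H2 m) (W : quasimatrix H1 n).
Hypotheses (oW : orthonormal_family W).

(* [W W^* A^* Z Z^* y] *)
Definition discr_adj (y : H2) : H1 := \sum_j <[A (W j), qm_outer Z y]> *: W j.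

Lemma discr_opP x y : <[A x - discr_op A Z W x, y]> = <[x, adjoint A y - discr_adj y]>.
Proof.
rewrite innerBl innerBr (adjointP o1 _ _ hsA); congr (_ - _).
rewrite inner_suml inner_sumr; under eq_bigr do rewrite mxE innerZl mulr_suml.
rewrite exchange_big /=; apply: eq_bigr => j _.
rewrite innerZr inner_sumr mulr_suml; apply: eq_bigr => i _.
by rewrite !mxE innerZr (innerC y); ring.
Qed.

(** On the adjoint side, W W^* A^* y is the best approximation of A^* y in the range of W, and the
    adjoint of the discretization takes its values in that range too. *)
Lemma hs2_truncation :
  (hs2 (fun x => A (x - qm_outer W x))%R <= hs2 (fun x => A x - discr_op A Z W x)%R)%E.
Proof.
have oq := oseq_family oW; set q := map W _ in oq.
rewrite (hs2_adjoint o1 o2 discr_opP).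
rewrite (@hs2_adjoint _ _ _ o1 o2 _ (fun y => adjoint A y - oproj q (adjoint A y))).
  apply: hs2_le => y; apply: best_approx => //.
  rewrite oproj_sum; apply: eq_bigr => j _; rewrite oprojZ oproj_mem//.
  by apply/mapP; exists j => //; rewrite mem_index_enum.
move=> x y; rewrite qm_outerE (adjointP o1 _ _ hsA) innerBl innerBr -/q.
by rewrite oproj_sym.
Qed.

Lemma rsvd_error_bound r (Yn Y : quasimatrix H2 r) (t delta M : R) :
  0 < t -> 0 <= delta -> (discr_error A Z W <= delta%:E)%E -> hs2 A = M%:E ->
  (forall (c : 'cV[R]_r) i, t * `|c i 0| <= `|qm_op Y c|) ->
  (hs_norm (fun x => rsvd A Y x - rsvd_discr A Z W Yn x)%R <=
   (2 * delta + 8 * Num.sqrt M * ((\sum_j `|Y j - qm_outer Z (Yn j)|) / t))%R%:E)%E.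
Proof.
move=> t0 d0 hd hM ht.
have M0 : 0 <= M by rewrite -lee_fin -hM hs2_ge0.
set S := \sum_j _; pose X : quasimatrix H2 r := qm_outer Z \o Yn.
have S0 : 0 <= S by apply: sumr_ge0.
have eta0 : 0 <= S / t by rewrite divr_ge0// ltW.
have XY c : `|qm_op X c - qm_op Y c| <= S / t * `|qm_op Y c|.
  rewrite /qm_op -sumrB; apply: le_trans (ler_norm_sum _ _ _) _.
  rewrite /S mulr_suml mulr_suml; apply: ler_sum => i _.
  rewrite -scalerBr normrZ distrC mulrC -mulrA ler_wpM2l//.
  by rewrite ler_pdivlMl// ht.
have [f [of_ fE fY fC]] := qm_projP Y; have [g [og gE gX gC]] := qm_projP X.
have pert := oproj_perturbation of_ og fY fC gX gC eta0 XY.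
have sq0 : 0 <= Num.sqrt M by exact: sqrtr_ge0.
rewrite hs_normE lee_sqr_sqrte ?hs2_ge0//; last first.
  by apply: addr_ge0; [exact: mulr_ge0|apply: mulr_ge0 => //; exact: mulr_ge0].
set eta := S / t in eta0 pert *.
(* Here 32 = 2 * 4^2: the perturbation factor is [4 * eta], and |u + v|^2 <= 2 |u|^2 + 2 |v|^2 is
   summed over the basis. *)
apply: (@le_trans _ _ (32 * eta ^+ 2 * M + 2 * delta ^+ 2)%:E); last first.
  have : Num.sqrt M ^+ 2 = M by rewrite sqr_sqrtr.
  rewrite lee_fin; set s := Num.sqrt M => <-.
  have : 0 <= delta * (s * eta) by apply: mulr_ge0 => //; exact: mulr_ge0.
  have : 0 <= (s * eta) ^+ 2 by rewrite sqr_ge0.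
  have : 0 <= delta ^+ 2 by rewrite sqr_ge0.
  by nra.
have trunc : (hs2 (fun x => A (x - qm_outer W x))%R <= (delta ^+ 2)%:E)%E.
  apply: (le_trans hs2_truncation).
  by rewrite -lee_sqr_sqrte ?hs2_ge0// -hs_normE.
have point x : `|rsvd A Y x - rsvd_discr A Z W Yn x| ^+ 2 <=
    32 * eta ^+ 2 * `|A x| ^+ 2 + 2 * `|A (x - qm_outer W x)| ^+ 2.
  rewrite /rsvd /rsvd_discr fE -/X gE.
  have -> : oproj f (A x) - oproj g (A (qm_outer W x)) =
      (oproj f (A x) - oproj g (A x)) + oproj g (A (x - qm_outer W x)).
    by rewrite linearB /= oprojB addrA subrK.
  have h1 := pert (A x).
  have h2 := norm_oproj_le (A (x - qm_outer W x)) og.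
  set u := oproj f (A x) - _ in h1 *; set v := oproj g (A (x - _)) in h2 *.
  have h3 : `|u + v| <= `|u| + `|v| by exact: ler_normD.
  have hu := normr_ge0 u; have hv := normr_ge0 v; have huv := normr_ge0 (u + v).
  have : `|u + v| ^+ 2 <= (`|u| + `|v|) ^+ 2 by rewrite ler_sqr ?nnegrE ?addr_ge0.
  have h4 : 0 <= 4 * eta * `|A x| by apply: mulr_ge0 => //; exact: mulr_ge0.
  have : `|u| ^+ 2 <= (4 * eta * `|A x|) ^+ 2 by rewrite ler_sqr ?nnegrE.
  have : `|v| ^+ 2 <= `|A (x - qm_outer W x)| ^+ 2 by rewrite ler_sqr ?nnegrE.
  have : 0 <= (`|u| - `|v|) ^+ 2 by rewrite sqr_ge0.
  by rewrite sqrrB sqrrD !exprMn; nra.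
apply: (@le_trans _ _ (\sum_(0 <= i <oo) ((32 * eta ^+ 2)%:E * (`|A (onb H1 i)| ^+ 2)%:E +
   2%:E * (`|A (onb H1 i - qm_outer W (onb H1 i))%R| ^+ 2)%:E))%E).
  apply: lee_nneseries => [i _ _|i _]; first by rewrite lee_fin sqr_ge0.
  by rewrite -!EFinM -EFinD lee_fin.
rewrite nneseriesD; last 2 first.
- by move=> i _ _; rewrite -EFinM lee_fin; apply: mulr_ge0; rewrite ?sqr_ge0//; apply: mulr_ge0; rewrite ?sqr_ge0.
- by move=> i _ _; rewrite mule_ge0 ?lee_fin ?sqr_ge0.
rewrite !nneseriesZl//; try by move=> i _; rewrite lee_fin sqr_ge0.
rewrite [leRHS]EFinD; apply: leeD.
  by rewrite [leRHS]EFinM -hM.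
by rewrite [leRHS]EFinM lee_wpmul2l ?lee_fin.
Qed.

End discretization.
End error_bound.

(** * The coupling *)

Section push_probability.
Context d d' (T : measurableType d) (T' : measurableType d') (R : realType).
Variables (P : probability T R) (f : T -> T') (mf : measurable_fun setT f).

Definition push_prob : probability T' R :=
  distribution P (HB.pack_for {mfun T >-> T'} f (isMeasurableFun.Build _ _ _ _ f mf)).

Lemma ge0_integral_push_prob (g : T' -> \bar R) : measurable_fun setT g ->
  (forall y, 0 <= g y)%E -> (\int[push_prob]_y g y = \int[P]_x g (f x))%E.
Proof. by move=> mg g0; rewrite ge0_integral_distribution. Qed.

End push_probability.

Section coupling.
Context {R : realType} (H1 H2 : hilbertType R).
Hypotheses (o1 : orthonormal_basis (onb H1)) (o2 : orthonormal_basis (onb H2)).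
Hypothesis sH2 : separable H2.
Variable A : {linear H1 -> H2}.
Hypothesis hsA : hilbert_schmidt A.
Local Notation "<[ x , y ]>" := (inner x y).
Local Notation As := (adjoint A).
Local Notation N1 := (@normal_prob R 0 1).

Lemma adjoint0 : As 0 = 0.
Proof. by apply: inner_allE => z; rewrite innerC -(adjointP o1 _ _ hsA) inner0r inner0l. Qed.

(* The range of the adjoint need not be closed, so [h] is only an almost minimizer
   of the distance from [w] to it. *)
Lemma near_projection w eps : 0 < eps -> exists h, forall h',
  `|w - As h'| <= `|w - As h| -> forall u, `|<[w - As h', As u]>| <= eps * `|As u|.
Proof.
move=> e0; pose E := [set `|w - As h| ^+ 2 | h in [set: H2]].
have infE : has_inf E.
  split; first by exists (`|w - As 0| ^+ 2), 0.
  by exists 0 => _ [h _ <-]; exact: sqr_ge0.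
have [_ [h _ <-] hE] := inf_adherent (exprn_gt0 2 e0) infE.
exists h => h' hh' u; set v := w - As h'.
have vE : `|v| ^+ 2 < inf E + eps ^+ 2.
  by apply: le_lt_trans hE; rewrite ler_sqr ?nnegrE.
have [Au0|Au0] := eqVneq (As u) 0; first by rewrite Au0 inner0r !normr0 mulr0.
set a := As u in Au0 *; have a2 : 0 < `|a| ^+ 2 by rewrite exprn_gt0 ?normr_gt0.
(* The optimal step along [a]: it lowers [|v| ^+ 2] by [<v, a> ^+ 2 / |a| ^+ 2], and no step can
   lower it by more than its excess over the infimum. *)
pose t := <[v, a]> / `|a| ^+ 2.
have : inf E <= `|v - t *: a| ^+ 2.
  apply: ge_inf; first exact: infE.2.
  exists (t *: u + h') => //; rewrite (adjointD o1 hsA) /v /a.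
  by rewrite opprD addrA addrAC.
rewrite normB_sqr innerZr normrZ exprMn real_normK ?num_real// => tE.
have : <[v, a]> ^+ 2 <= eps ^+ 2 * `|a| ^+ 2.
  rewrite -ler_pdivrMr//.
  have -> : <[v, a]> ^+ 2 / `|a| ^+ 2 = 2 * (t * <[v, a]>) - t ^+ 2 * `|a| ^+ 2.
    by rewrite /t; field; rewrite normr_eq0.
  by lra.
by move=> h2; rewrite -ler_sqr ?nnegrE ?mulr_ge0 ?(ltW e0)// real_normK ?num_real// exprMn.
Qed.

Section construction.
Variables (m n : nat) (Z : quasimatrix H2 m) (W : quasimatrix H1 n).
Hypotheses (oW : orthonormal_family W).
Variables (mu mun : probability (borel H2) R).
Hypotheses (gmu : gaussian mu (A \o As)) (gmun : gaussian mun (A \o qm_outer W \o As)).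

Variables (q f : seq H1).
Hypotheses (ofq : oseq (f ++ q)) (qA : forall e, e \in q -> range As e).
Hypothesis fqW : forall j, oproj (f ++ q) (W j) = W j.

Let oq : oseq q := oseq_catr ofq.
Let N := size f.
Let Om := (borel H2 * N.-tuple (measurableTypeR R))%type.
Let P : probability Om R := (mu \x power_prob N1 N)%E.

(** One preimage under the adjoint is fixed for each element of [q], which makes the lift linear.
    For y = A g one has formally [<lift_adj x, y>] = [<oproj q x, g>]. *)
Let lift_adj (x : H1) : H2 := \sum_(e <- q) <[x, e]> *: xget 0 [set h | As h = e].

Let adjoint_lift x : As (lift_adj x) = oproj q x.
Proof.
rewrite /lift_adj /oproj.
have : forall e, e \in q -> As (xget 0 [set h | As h = e]) = e.
  move=> e eq; have [h _ he] := qA eq.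
  by apply: (@xgetPex _ 0 [set h | As h = e]); exists h.
elim: q => [|e s IH] hs; first by rewrite !big_nil adjoint0.
rewrite !big_cons (adjointD o1 hsA) hs ?mem_head// IH// => g gs.
by apply: hs; rewrite inE gs orbT.
Qed.

(* White noise on the span of [f ++ q]: the coordinates along [q], which lies in
   the range of the adjoint, are read off the sample of [mu]. *)
Let noise (x : H1) (om : Om) : R :=
  <[lift_adj x, om.1]> + \sum_(i < N) <[x, f`_i]> * tnth om.2 i.

Let lift_adjD a x y : lift_adj (a *: x + y) = a *: lift_adj x + lift_adj y.
Proof.
rewrite /lift_adj scaler_sumr -big_split; apply: eq_bigr => e _.
by rewrite innerDl innerZl scalerDl scalerA.
Qed.

Let noiseD a x y om : noise (a *: x + y) om = a * noise x om + noise y om.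
Proof.
rewrite /noise lift_adjD innerDl innerZl mulrDr mulr_sumr addrACA; congr (_ + _).
rewrite -big_split; apply: eq_bigr => i _ /=.
by rewrite innerDl innerZl; ring.
Qed.

Let noise0 om : noise 0 om = 0.
Proof. by have := noiseD (-1) 0 0 om; rewrite scaler0 addr0 mulN1r addNr. Qed.

Let noise_sum k (c : 'I_k -> R) (x : 'I_k -> H1) om :
  noise (\sum_i c i *: x i) om = \sum_i c i * noise (x i) om.
Proof.
elim: k c x => [|k IH] c x; first by rewrite !big_ord0 noise0.
by rewrite !big_ord_recl noiseD IH.
Qed.

(** The vector A W W^* g, with [noise (W j)] in place of the inner product of w_j and g. *)
Let yn (om : Om) : H2 := \sum_j noise (W j) om *: A (W j).

(** This is W W^* A^* v, the direction of the noise seen by the functional [inner v] of [yn]. *)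
Let a_ (v : H2) : H1 := \sum_j <[A (W j), v]> *: W j.

Let inner_yn v om : <[v, yn om]> = noise (a_ v) om.
Proof.
rewrite /a_ noise_sum /yn inner_sumr; apply: eq_bigr => j _.
by rewrite innerZr mulrC (innerC v).
Qed.

Let proj_a v : oproj (f ++ q) (a_ v) = a_ v.
Proof. by rewrite oproj_sum; apply: eq_bigr => j _; rewrite oprojZ fqW. Qed.

Let measurable_noise x : measurable_fun setT (noise x).
Proof.
apply: measurable_funD.
  by apply: (measurableT_comp (measurable_inner (lift_adj x))); exact: measurable_fst.
apply: measurable_sum => i; apply: measurable_funM => //.
exact: (measurableT_comp (@measurable_tnth _ _ _ i) measurable_snd).
Qed.

(** For a genuine white noise behind both terms the variance would be [|As u + x| ^+ 2]. The
    coordinates along [f] are independent of the sample, so the cross term only sees [oproj q x]. *)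
Let law u x : oproj (f ++ q) x = x -> normal_law P (fun om => <[u, om.1]> + noise x om)
  (`|As u| ^+ 2 + 2 * <[As u, oproj q x]> + `|x| ^+ 2).
Proof.
move=> xE.
have -> : (fun om : Om => <[u, om.1]> + noise x om) =
    (fun om => <[u + lift_adj x, om.1]> + \sum_(i < N) <[x, f`_i]> * tnth om.2 i).
  by apply/funext => om; rewrite /noise innerDl addrA.
have -> : `|As u| ^+ 2 + 2 * <[As u, oproj q x]> + `|x| ^+ 2 =
    `|As (u + lift_adj x)| ^+ 2 + \sum_(i < N) <[x, f`_i]> ^+ 2.
  have xn : `|x| ^+ 2 = `|oproj q x| ^+ 2 + \sum_(i < N) <[x, f`_i]> ^+ 2.
    rewrite -[in LHS]xE !norm_oproj_sqr// big_cat addrC; congr (_ + _).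
    by rewrite (big_nth 0) big_mkord.
  rewrite xn addrA; congr (_ + _).
  by rewrite -[u in RHS]scale1r (adjointD o1 hsA) !scale1r adjoint_lift normD_sqr.
apply: (@normal_law_add _ _ _ _ _ mu (power_prob N1 N) (inner (u + lift_adj x))
  (fun z => \sum_(i < N) <[x, f`_i]> * tnth z i)).
- exact: measurable_inner.
- apply: measurable_sum => i; apply: measurable_funM => //; exact: measurable_tnth.
- exact: sqr_ge0.
- by apply: sumr_ge0 => i _; exact: sqr_ge0.
- move=> B mB; have := gmu (u + lift_adj x) mB.
  by rewrite [(A \o As) _]/= (adjointP o1 _ _ hsA) inner_normE.
- exact: normal_law_power.
Qed.

Let weak_yn : weakly_measurable yn.
Proof. by move=> h; under eq_fun do rewrite inner_yn; exact: measurable_noise. Qed.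

Let measurable_yn : measurable_fun setT (yn : Om -> borel H2).
Proof. exact: weakly_measurableP. Qed.

Let measurable_pair : measurable_fun setT ((fun om => (yn om, om.1)) : Om -> borel (H2 * H2)%type).
Proof. by apply: (measurable_borel_pair sH2 sH2) => //; exact: measurable_fst. Qed.

Definition coupling_of := push_prob P measurable_pair.

Lemma coupling_ofP : couplings mun mu coupling_of.
Proof.
move=> B mB; split; last first.
  transitivity (P (B `*` setT)).
    transitivity (P (fst @^-1` B)); first by [].
    by congr (P _); apply/seteqP; split => -[x y] /=; [split|case].
  apply: etrans; first exact: (@product_measure1E _ _ _ _ _ mu (power_prob N1 N) _ _ mB measurableT).
  by rewrite [X in (_ * X)%E]probability_setT mule1.
transitivity (push_prob P measurable_yn B); first by [].
apply: (gaussian_unique sH2 o2) mB => h C mC; rewrite gmun//.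
(* For [u = 0] only the noise in direction [a_ h] remains, and its variance is the squared norm of W
   W^* A^* h. *)
have := law 0 (proj_a h) mC.
rewrite adjoint0 normr0 expr0n inner0l mulr0 !add0r => lawh.
transitivity (P [set om | C (<[0, om.1]> + noise (a_ h) om)]).
  by congr (P _); apply/seteqP; split => om /=; rewrite inner_yn inner0l add0r.
rewrite [LHS]lawh; congr (centered_normal _ _).
have aE : a_ h = qm_outer W (As h).
  by apply: eq_bigr => j _; rewrite mxE (adjointP o1 _ _ hsA) innerC.
rewrite aE /= (adjointP o1 _ _ hsA) -inner_normE !qm_outerE.
by rewrite -oproj_sym oproj_idem//; exact: oseq_family.
Qed.

Let discr_adjE u : discr_adj A Z W u = a_ (qm_outer Z u).
Proof. by []. Qed.

Let inner_error u om : <[om.1 - qm_outer Z (yn om), u]> =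
  <[u, om.1]> + noise (- discr_adj A Z W u) om.
Proof.
have -> : noise (- discr_adj A Z W u) om = - <[qm_outer Z u, yn om]>.
  have := noiseD (-1) (discr_adj A Z W u) 0 om.
  by rewrite addr0 noise0 addr0 scaleN1r mulN1r inner_yn discr_adjE.
by rewrite innerBl qm_outer_sym innerC (innerC (yn om)).
Qed.

Variables (eps M : R).
Hypotheses (eps0 : 0 <= eps) (hM : hs2 A = M%:E).
Hypothesis near : forall j u, `|<[W j - oproj q (W j), As u]>| <= eps * `|As u|.

(** The variance exceeds its white-noise value only through the part of each w_j outside the span of
    [q], which is nearly orthogonal to [As u]. The excess is put into squares by 2ab <= a^2 + b^2,
    so that it can be summed over a basis. *)
Let var_bound u : `|As u| ^+ 2 + 2 * <[As u, oproj q (- discr_adj A Z W u)]> +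
    `|- discr_adj A Z W u| ^+ 2 <=
  `|As u - discr_adj A Z W u| ^+ 2 +
  eps * \sum_j (`|As u| ^+ 2 + <[qm_outer Z (A (W j)), u]> ^+ 2).
Proof.
set x := discr_adj A Z W u.
rewrite normrN oprojN innerNr normB_sqr.
suff : <[x - oproj q x, As u]> *+ 2 <=
    eps * \sum_j (`|As u| ^+ 2 + <[qm_outer Z (A (W j)), u]> ^+ 2).
  by rewrite mulr2n innerBl (innerC x) (innerC (oproj q x)); lra.
rewrite /x /discr_adj oproj_sum -sumrB inner_suml mulr_sumr -sumrMnl.
apply: ler_sum => j _; rewrite oprojZ -scalerBr innerZl -qm_outer_sym.
set c := <[_, u]>; have := near j u; set b := <[_, As u]> => hb.
have : c * b <= `|c| * (eps * `|As u|).
  by rewrite (le_trans (ler_norm _))// normrM ler_wpM2l.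
have -> : c ^+ 2 = `|c| ^+ 2 by rewrite real_normK ?num_real.
have : 0 <= eps * (`|As u| - `|c|) ^+ 2 by rewrite mulr_ge0 ?sqr_ge0.
by rewrite mulr2n sqrrB; lra.
Qed.

(** By Parseval the cost is a series of second moments of normal variables, whence the factor 8.
    Summing [var_bound] over the basis gives the squared discretization error, read on the adjoint
    side, plus a multiple of [eps]. *)
Lemma coupling_of_cost :
  (\int[coupling_of]_x (`|x.2 - qm_outer Z x.1| ^+ 2)%:E <=
   8%:E * (hs2 (fun x => A x - discr_op A Z W x)%R +
     (eps * \sum_j (M + `|qm_outer Z (A (W j))| ^+ 2))%:E))%E.
Proof.
pose K : R := \sum_j (M + `|qm_outer Z (A (W j))| ^+ 2).
have mg : measurable_fun [set: borel (H2 * H2)%type]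
    (fun x : borel (H2 * H2)%type => (`|x.2 - qm_outer Z x.1| ^+ 2)%:E).
  apply/measurable_EFinP; apply: (weakly_measurable_norm o2) => h.
  have m1 := @measurable_borel_fst R H2 H2; have m2 := @measurable_borel_snd R H2 H2.
  under eq_fun do rewrite innerBr -qm_outer_sym.
  apply: measurable_funB; first exact: (measurableT_comp (measurable_inner h) m2).
  exact: (measurableT_comp (measurable_inner (qm_outer Z h)) m1).
rewrite ge0_integral_push_prob//.
rewrite /=.
under eq_integral do rewrite -(parseval o2).
rewrite integral_nneseries//; last 2 first.
- move=> i; apply/measurable_EFinP/measurable_funX.
  under eq_fun do rewrite inner_error.
  apply: measurable_funD; last exact: measurable_noise.
  exact: (measurableT_comp (measurable_inner _) measurable_fst).
- by move=> i x _; rewrite lee_fin sqr_ge0.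
apply: (@le_trans _ _ (\sum_(0 <= i <oo) (8%:E * ((`|As (onb H2 i) - discr_adj A Z W (onb H2 i)| ^+ 2)%:E +
    eps%:E * \sum_j ((`|As (onb H2 i)| ^+ 2)%:E +
      (<[qm_outer Z (A (W j)), onb H2 i]> ^+ 2)%:E))))%E).
  apply: lee_nneseries => [i _ _|i _].
    by apply: integral_ge0 => x _; rewrite lee_fin sqr_ge0.
  under eq_integral do rewrite inner_error.
  set u := onb H2 i.
  have xE : oproj (f ++ q) (- discr_adj A Z W u) = - discr_adj A Z W u.
    by rewrite oprojN discr_adjE proj_a.
  apply: (le_trans (normal_law_second_moment _ (law u xE) _)).
  - apply: measurable_funD; last exact: measurable_noise.
    exact: (measurableT_comp (measurable_inner _) measurable_fst).
  - have := norm_oproj_le (- discr_adj A Z W u) oq.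
    rewrite -ler_sqr ?nnegrE// => h; have := sqr_ge0 `|As u + oproj q (- discr_adj A Z W u)|.
    by rewrite normD_sqr; lra.
  rewrite EFinM lee_wpmul2l ?lee_fin//.
  by under eq_bigr do rewrite -EFinD; rewrite sumEFin -EFinM -EFinD lee_fin.
have term0 i : (0 <= \sum_j ((`|As (onb H2 i)| ^+ 2)%:E +
      (<[qm_outer Z (A (W j)), onb H2 i]> ^+ 2)%:E))%E.
  by apply: sume_ge0 => j _; rewrite adde_ge0 ?lee_fin ?sqr_ge0.
have epsterm0 i : (0 <= eps%:E * \sum_j ((`|As (onb H2 i)| ^+ 2)%:E +
      (<[qm_outer Z (A (W j)), onb H2 i]> ^+ 2)%:E))%E.
  by rewrite mule_ge0 ?lee_fin.
rewrite nneseriesZl; last by move=> i _; rewrite adde_ge0 ?lee_fin ?sqr_ge0.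
apply: lee_wpmul2l; first by rewrite lee_fin.
rewrite nneseriesD; last 2 first.
- by move=> i _ _; rewrite lee_fin sqr_ge0.
- by [].
rewrite (hs2_adjoint o1 o2 (discr_opP o1 hsA Z W)) leeD2l//.
rewrite nneseriesZl//.
rewrite EFinM lee_wpmul2l ?lee_fin// nneseries_sum; last first.
  by move=> j i _; rewrite adde_ge0 ?lee_fin ?sqr_ge0.
rewrite -sumEFin; apply: lee_sum => j _.
rewrite nneseriesD; last 2 first.
- by move=> i _ _; rewrite lee_fin sqr_ge0.
- by move=> i _ _; rewrite lee_fin sqr_ge0.
rewrite (parseval o2) EFinD leeD2r// -hM.
by rewrite (hs2_adjoint o1 o2 (fun x y => adjointP o1 x y hsA)).
Qed.

End construction.

Lemma exists_coupling m n (Z : quasimatrix H2 m) (W : quasimatrix H1 n)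
    (mu mun : probability (borel H2) R) (delta D M : R) :
  orthonormal_family W -> gaussian mu (A \o As) -> gaussian mun (A \o qm_outer W \o As) ->
  hs2 A = M%:E -> 0 <= delta -> delta < D -> (discr_error A Z W <= delta%:E)%E ->
  exists2 gamma, couplings mun mu gamma &
    (\int[gamma]_x (`|x.2 - qm_outer Z x.1| ^+ 2)%:E <= (8 * D ^+ 2)%:E)%E.
Proof.
move=> oW gmu gmun hM d0 dD hd.
have M0 : 0 <= M by rewrite -lee_fin -hM hs2_ge0.
pose K := \sum_j (M + `|qm_outer Z (A (W j))| ^+ 2).
have K0 : 0 <= K by apply: sumr_ge0 => j _; rewrite addr_ge0 ?sqr_ge0.
have dD2 : 0 < D ^+ 2 - delta ^+ 2 by nra.
(* Chosen so that [eps * K], the defect in the coupling cost, fits between [delta ^+ 2] and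
   [D ^+ 2]. *)
pose eps := (D ^+ 2 - delta ^+ 2) / (K + 1).
have eps0 : 0 < eps by rewrite divr_gt0// ltr_wpDl.
have /choice[h hP] := fun j => near_projection (W j) eps0.
pose S := range As.
have S0 : S 0 by exists 0 => //; exact: adjoint0.
have Slin a x y : S x -> S y -> S (a *: x + y).
  by move=> [u _ <-] [v _ <-]; exists (a *: u + v) => //; exact: (adjointD o1 hsA).
have Sh x : x \in map (As \o h) (index_enum 'I_n) -> S x.
  by move=> /mapP[i _ ->]; exists (h i).
have [//|q []] := @oseq_extend_in R H1 S [::] _ Slin S0 _ Sh I.
rewrite cats0 => oq qh qA.
have [f ofq fW] := oseq_extend (map W (index_enum 'I_n)) oq.
have fqW j : oproj (f ++ q) (W j) = W j.
  by apply: fW; apply/mapP; exists j => //; rewrite mem_index_enum.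
(* The span of [q] contains [As (h j)], so projecting [W j] on it does at least as well as this
   almost minimizer; and the projection is itself in the range of the adjoint. *)
have near j u : `|<[W j - oproj q (W j), As u]>| <= eps * `|As u|.
  have [h' _ h'E] := oproj_in (W j) Slin S0 qA.
  rewrite -h'E; apply: (hP j); rewrite h'E; apply: best_approx => //.
  by apply: qh; apply/mapP; exists j => //; rewrite mem_index_enum.
exists (coupling_of W mu q f); first exact: coupling_ofP.
apply: le_trans (coupling_of_cost Z gmu ofq qA fqW (ltW eps0) hM near) _.
rewrite [leRHS]EFinM lee_wpmul2l ?lee_fin// -/K.
have : (hs2 (fun x => A x - discr_op A Z W x)%R <= (delta ^+ 2)%:E)%E.
  by rewrite -lee_sqr_sqrte ?hs2_ge0// -hs_normE.
move=> hd2; apply: (le_trans (leeD2r _ hd2)); rewrite -EFinD lee_fin.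
have : eps * K <= D ^+ 2 - delta ^+ 2.
  by rewrite /eps mulrAC ler_pdivrMr ?ltr_wpDl// ler_wpM2l ?ltW// ltrDl.
by lra.
Qed.
End coupling.

(** * Independent samples and the inverse moment *)

(* No measurability is assumed: the integral of a nonnegative function is a
   supremum over the simple functions below it. *)
Lemma ge0_le_integral_any d (T : measurableType d) (R : realType)
    (mu : {measure set T -> \bar R}) (f g : T -> \bar R) :
  (forall x, 0 <= f x)%E -> (forall x, f x <= g x)%E ->
  (\int[mu]_x f x <= \int[mu]_x g x)%E.
Proof.
move=> f0 fg; rewrite !ge0_integralTE//; last by move=> x; exact: le_trans (fg x).
apply: le_ereal_sup => _ [h hf <-]; exists h => // x.
exact: le_trans (hf x) (fg x).
Qed.

Lemma integral_cst_probability d (T : measurableType d) (R : realType)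
  (P : probability T R) (c : R) : (\int[P]_x (cst c%:E x) = c%:E)%E.
Proof. by rewrite integral_cst// [X in (_ * X)%E]probability_setT mule1. Qed.

Section power_integral.
Context d (T : measurableType d) (R : realType) (P : probability T R).

Definition upd n (om : n.-tuple T) (j : 'I_n) (y : T) : n.-tuple T :=
  [tuple if i == j then y else tnth om i | i < n].

Lemma upd_cons0 n x (z : n.-tuple T) y :
  upd (tuple_cons (x, z)) ord0 y = tuple_cons (y, z).
Proof.
apply: eq_from_tnth => i; rewrite tnth_mktuple.
have [j ->|->] := unliftP ord0 i; first by rewrite !tnth_tuple_cons.
by rewrite eqxx.
Qed.

Lemma upd_cons n x (z : n.-tuple T) j y :
  upd (tuple_cons (x, z)) (lift ord0 j) y = tuple_cons (x, upd z j y).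
Proof.
apply: eq_from_tnth => i; rewrite tnth_mktuple.
have [k ->|->] := unliftP ord0 i; last by [].
by rewrite !tnth_tuple_cons tnth_mktuple (inj_eq lift_inj).
Qed.

(** Conditioning on all coordinates but the [j]-th, by Tonelli. *)
Lemma integral_power_prob_le n (f : n.-tuple T -> \bar R) (j : 'I_n) (c : R) :
  measurable_fun setT f -> (forall om, 0 <= f om)%E ->
  (forall om, \int[P]_y f (upd om j y) <= c%:E)%E ->
  (\int[power_prob P n]_om f om <= c%:E)%E.
Proof.
elim: n f j => [f [] //|n IH] f j mf f0 fc.
have mfc : measurable_fun setT (f \o @tuple_cons _ _ n).
  by apply: measurableT_comp => //; exact: measurable_tuple_cons.
have fc0 x : (0 <= (f \o @tuple_cons _ _ n) x)%E by exact: f0.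
rewrite /= ge0_integral_distribution//.
have [k jk|j0] := unliftP ord0 j.
  rewrite (fubini_tonelli1 _ mfc fc0)//.
  apply: (@le_trans _ _ (\int[P]_x (cst c%:E x))%E); last by rewrite integral_cst_probability.
  apply: ge0_le_integral_any => x; first by apply: integral_ge0 => y _; exact: f0.
  apply: (IH (fun z => f (tuple_cons (x, z))) k) => //.
    by apply: (measurableT_comp mfc); exact: pair1_measurable.
  by move=> z; have := fc (tuple_cons (x, z)); rewrite jk; under eq_integral do rewrite upd_cons.
rewrite (fubini_tonelli2 _ mfc fc0)//.
apply: (@le_trans _ _ (\int[power_prob P n]_x (cst c%:E x))%E).
  apply: ge0_le_integral_any => z; first by apply: integral_ge0 => y _; exact: f0.
  (* The entry [point] is a dummy that the update overwrites. *)
  by have := fc (tuple_cons (point, z)); rewrite j0; under eq_integral do rewrite upd_cons0.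
by rewrite integral_cst_probability.
Qed.

End power_integral.

(** * Directions orthogonal to given samples *)

Section frames.
Context {R : realType} (H1 H2 : hilbertType R).
Hypotheses (o1 : orthonormal_basis (onb H1)).
Variable A : {linear H1 -> H2}.
Hypothesis hsA : hilbert_schmidt A.
Local Notation "<[ x , y ]>" := (inner x y).
Local Notation As := (adjoint A).

(** Gram--Schmidt for the form [<As h, As h'>]. Each new vector must be orthogonal to [vs] and to
    [A (As h)] for the earlier [h]; there are fewer such equations than dimensions as long as
    [size vs + k <= N]. *)
Lemma orthonormal_in_span N (x : 'I_N -> H2) k (vs : seq H2) :
  (forall c : 'I_N -> R, As (\sum_i c i *: x i) = 0 -> forall i, c i = 0) ->
  (size vs + k <= N)%N ->
  exists hs : seq H2, [/\ size hs = k, oseq (map As hs) &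
    forall h, h \in hs -> (exists c : 'I_N -> R, h = \sum_i c i *: x i) /\
      forall v, v \in vs -> <[h, v]> = 0].
Proof.
move=> xi; elim: k => [|k IH] kN; first by exists [::].
have [|hs [sk ohs hsP]] := IH; first by apply: leq_trans kN; rewrite leq_add2l.
pose us := map (A \o As) hs ++ vs.
have [|c c0 cM] := kernel_row (\matrix_(i < N, j < size us) <[x i, us`_j]>).
  by rewrite size_cat size_map sk addnC; move: kN; rewrite addnS.
pose z := \sum_i c 0 i *: x i.
have zu u : u \in us -> <[z, u]> = 0.
  move=> /(nthP 0)[j jlt <-].
  move/matrixP: cM => /(_ 0 (Ordinal jlt)); rewrite !mxE => cM.
  by rewrite inner_suml -[RHS]cM; apply: eq_bigr => i _; rewrite innerZl mxE.
have Az0 : `|As z| != 0.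
  rewrite normr_eq0; apply: contraNneq c0 => Az.
  by apply/eqP/rowP => i; rewrite mxE; exact: (xi (fun i => c 0 i) Az).
have AsZ a y : As (a *: y) = a *: As y.
  by rewrite -[a *: y]addr0 (adjointD o1 hsA) (adjoint0 o1 hsA) addr0.
exists (`|As z|^-1 *: z :: hs); split => [||h]; first by rewrite /= sk.
  rewrite /=; split => //; first by rewrite AsZ normrZ normfV normr_id mulVf.
  move=> _ /mapP[h hhs ->]; rewrite AsZ innerZl innerC -(adjointP o1 _ _ hsA) innerC zu ?mulr0//.
  by rewrite mem_cat; apply/orP; left; apply/mapP; exists h.
rewrite inE => /orP[/eqP->|/hsP//]; split.
  by exists (fun i => `|As z|^-1 * c 0 i); rewrite scaler_sumr; apply: eq_bigr => i _; rewrite scalerA.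
by move=> v vvs; rewrite innerZl zu ?mulr0// mem_cat vvs orbT.
Qed.

(** The adjoint is injective on the range of [A]: if y = A x and As y = 0, then [<y, y>] =
    [<x, As y>] = 0. *)
Lemma adjoint_indep N : rank_ge A N -> exists x : 'I_N -> H2,
  forall c : 'I_N -> R, As (\sum_i c i *: x i) = 0 -> forall i, c i = 0.
Proof.
move=> [y [yA yi]]; exists y => c Ac; apply: yi; apply/eqP.
have /choice[x xE] : forall i, exists x, A x = y i by move=> i; have [x _ <-] := yA i; exists x.
rewrite -normr_eq0 -sqrf_eq0 -inner_normE {1}(_ : \sum_i _ = A (\sum_i c i *: x i)).
  by rewrite (adjointP o1 _ _ hsA) Ac inner0r.
by rewrite linear_sum; apply: eq_bigr => i _; rewrite linearZ /= xE.
Qed.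

(** The bound [kappa] has to precede [vs], which will consist of random samples. All frames are
    taken in the span of one fixed frame [h]; since the images [As (h i)] are orthonormal and the
    image of a frame vector has norm 1, its coefficients are at most 1 in absolute value. *)
Lemma orthogonal_frame N : rank_ge A N -> exists2 kappa : R, 0 < kappa &
  forall k vs, (size vs + k <= N)%N -> exists q : 'I_k -> H2,
    [/\ orthonormal_family (As \o q), (forall i, `|q i| <= kappa) &
        forall i v, v \in vs -> <[q i, v]> = 0].
Proof.
move=> rA; have [x xi] := adjoint_indep rA.
have [|hs [shs ohs _]] := @orthonormal_in_span N x N [::] xi; first by [].
pose h (i : 'I_N) := hs`_i.
have oh : orthonormal_family (As \o h).
  move=> i j; have := oseq_nth ohs; rewrite size_map shs => /(_ i j).
  by rewrite /= !(nth_map 0) ?shs.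
have Ah (c : 'I_N -> R) : `|As (\sum_i c i *: h i)| ^+ 2 = \sum_i c i ^+ 2.
  by rewrite (adjoint_sum o1 hsA) (norm_orthonormal_sum c (index_enum_uniq _) oh).
have hi (c : 'I_N -> R) : As (\sum_i c i *: h i) = 0 -> forall i, c i = 0.
  move=> Ac i; have := Ah c; rewrite Ac normr0 expr0n => /esym/psumr_eq0P => /(_ _ i isT)/eqP.
  by rewrite sqrf_eq0 => h0; apply/eqP/h0 => j _; exact: sqr_ge0.
exists (\sum_i `|h i| + 1); first by rewrite ltr_wpDl// sumr_ge0.
move=> k vs kN; have [gs [sgs ogs gsP]] := orthonormal_in_span hi kN.
have mem (i : 'I_k) : gs`_i \in gs by rewrite mem_nth ?sgs.
exists (fun i => gs`_i); split => [i j|i|i v vvs].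
- have := oseq_nth ogs; rewrite size_map sgs => /(_ i j).
  by rewrite /= !(nth_map 0) ?sgs.
- have [[c cE] _] := gsP _ (mem i).
  have A1 : `|As gs`_i| ^+ 2 = 1.
    have := oseq_nth ogs; rewrite size_map sgs => /(_ i i).
    by rewrite eqxx (nth_map 0) ?sgs// inner_normE.
  apply: (@le_trans _ _ (\sum_i `|h i|)); last by rewrite lerDl.
  rewrite cE; apply: le_trans (ler_norm_sum _ _ _) _; apply: ler_sum => j _.
  rewrite normrZ ler_piMl// -[leRHS]ger0_norm// -ler_sqr ?nnegrE// real_normK ?num_real//.
  rewrite normr1 expr1n -A1 cE Ah (bigD1 j)//= lerDl.
  by apply: sumr_ge0 => l _; exact: sqr_ge0.
- by have [_] := gsP _ (mem i); apply.
Qed.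

End frames.

(** * Distances of the samples to the spans of the others *)

Section inverse_moment.
Context {R : realType} (H1 H2 : hilbertType R).
Hypotheses (o1 : orthonormal_basis (onb H1)) (o2 : orthonormal_basis (onb H2)).
Variable A : {linear H1 -> H2}.
Hypothesis hsA : hilbert_schmidt A.
Local Notation "<[ x , y ]>" := (inner x y).
Local Notation As := (adjoint A).
Variables (r : nat) (mu mun : probability (borel H2) R).
Hypotheses (rA : rank_ge A (r + 2)) (gmu : gaussian mu (A \o As)).
Local Notation T := (borel (H2 * H2)%type).

Definition sample (om : r.-tuple T) (j : 'I_r) : H2 := (tnth om j : H2 * H2).2.

(* The [j]-th sample is within [t] of the span of the others; rational
   coefficients keep the union countable. *)
Definition near_span (j : 'I_r) (t : R) : set (r.-tuple T) :=
  \bigcup_(c in [set: {ffun 'I_r -> rat}])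
    [set om | `|sample om j - \sum_(i | i != j) ratr (c i) *: sample om i| < t].

Lemma measurable_near_span j t : measurable (near_span j t).
Proof.
apply: countable_bigcupT_measurable => [|c]; first exact: countableP.
pose v (om : r.-tuple T) : H2 := sample om j - \sum_(i | i != j) ratr (c i) *: sample om i.
have ms i h : measurable_fun setT (fun om : r.-tuple T => <[h, sample om i]>).
  have m2 := measurableT_comp (measurable_inner h) (@measurable_borel_snd R H2 H2).
  exact: (measurableT_comp m2 (@measurable_tnth _ _ _ i)).
have wv : weakly_measurable v.
  move=> h; under eq_fun do rewrite innerBr inner_sumr big_mkcond.
  apply: measurable_funB => //; apply: measurable_sum => i; case: (i != j) => //.
  by under eq_fun do rewrite innerZr; apply: measurable_funM.
have := weakly_measurable_ball o2 0 t wv; congr measurable; apply/seteqP.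
by split => om /=; rewrite -ball_normE /ball_ /= sub0r normrN.
Qed.

(** If the bound failed at [c] and [j], division by [c j 0] would put the [j]-th sample strictly
    within [t] of a real combination of the others, and rational coefficients can be fitted into the
    slack. *)
Lemma near_span_lower (om : r.-tuple T) t : (forall j, ~ near_span j t om) ->
  forall (c : 'cV[R]_r) i, t * `|c i 0| <= `|qm_op (sample om) c|.
Proof.
move=> far c j; rewrite leNgt; apply/negP => lt.
have cj0 : c j 0 != 0.
  by apply: contraTneq lt => ->; rewrite normr0 mulr0 -leNgt.
have cjp : 0 < `|c j 0| by rewrite normr_gt0.
pose b i := - c i 0 / c j 0.
have vE : sample om j - \sum_(i | i != j) b i *: sample om i = (c j 0)^-1 *: qm_op (sample om) c.
  rewrite /qm_op [in RHS](bigD1 j)//= scalerDr scalerA mulVf// scale1r; congr (_ + _).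
  rewrite scaler_sumr -sumrN; apply: eq_bigr => i _.
  by rewrite scalerA -scaleNr /b mulNr opprK mulrC.
have vt : `|sample om j - \sum_(i | i != j) b i *: sample om i| < t.
  by rewrite vE normrZ normfV mulrC ltr_pdivrMr.
set g := `|_| in vt; pose S := \sum_i `|sample om i|.
have S0 : 0 <= S by apply: sumr_ge0.
have e0 : 0 < (t - g) / (S + 1) by rewrite divr_gt0 ?subr_gt0// ltr_wpDl.
have /choice[a aP] : forall i, exists q : rat, `|b i - ratr q| < (t - g) / (S + 1).
  move=> i; have [|q] := @rat_in_itvoo R (b i) (b i + (t - g) / (S + 1)); first by rewrite ltrDl.
  rewrite in_itv /= => /andP[q1 q2]; exists q; rewrite distrC gtr0_norm ?subr_gt0//.
  by rewrite ltrBlDl.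
apply: (far j); exists [ffun i => a i] => //=.
have -> : sample om j - \sum_(i | i != j) ratr ([ffun i => a i] i) *: sample om i =
    (sample om j - \sum_(i | i != j) b i *: sample om i) +
    \sum_(i | i != j) (b i - ratr (a i)) *: sample om i.
  rewrite -addrA; congr (_ + _); rewrite -sumrN -sumrN -big_split; apply: eq_bigr => i _ /=.
  by rewrite ffunE scalerBl addrA addNr sub0r.
apply: le_lt_trans (ler_normD _ _) _; rewrite -/g -ltrBrDl.
apply: (@le_lt_trans _ _ ((t - g) / (S + 1) * S)); last first.
  by rewrite mulrAC ltr_pdivrMr ?ltr_wpDl// ltr_pM2l ?subr_gt0// ltrDl.
apply: le_trans (ler_norm_sum _ _ _) _; rewrite /S mulr_sumr big_mkcond.
apply: ler_sum => i _; case: ifP => _; last by rewrite mulr_ge0 ?(ltW e0).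
by rewrite normrZ ler_wpM2r// ltW.
Qed.

Variables (gamma : probability T R).
Hypothesis hgamma : couplings mun mu gamma.
Variable kappa : R.
Hypothesis kappa0 : 0 < kappa.
Hypothesis frame : forall k vs, (size vs + k <= r + 2)%N -> exists q : 'I_k -> H2,
    [/\ orthonormal_family (As \o q), (forall i, `|q i| <= kappa) &
        forall i v, v \in vs -> <[q i, v]> = 0].

(** With the other samples fixed, three unit-variance functionals vanish on them. On the event these
    are all below [kappa * t] at the [j]-th sample, whose law under [gamma] is [mu]. *)
Lemma near_span_prob j t : 0 <= t ->
  (\int[power_prob gamma r]_om (\1_(near_span j t) om)%:E <= ((2 * (kappa * t)) ^+ 3)%:E)%E.
Proof.
move=> t0; have mn := measurable_near_span j t.
apply: (@integral_power_prob_le _ _ _ gamma _ (fun om => (\1_(near_span j t) om)%:E) j).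
- exact/measurable_EFinP/measurable_indic.
- by move=> om; rewrite lee_fin indicE.
move=> om; pose vs := [seq sample om i | i in predC1 j].
(* There are [r - 1] other samples, and [r - 1 + 3 = r + 2]: this is where the rank hypothesis is
   spent. *)
have [|q [oq qk qv]] := @frame 3 vs.
  have r0 : (0 < r)%N by exact: leq_ltn_trans (leq0n j) (ltn_ord j).
  by rewrite size_image cardC1 card_ord addnS -addSn prednK.
pose S : set T := snd @^-1` [set y : borel H2 | forall i, `|<[q i, y]>| < kappa * t].
have mB : measurable [set y : borel H2 | forall i, `|<[q i, y]>| < kappa * t].
  suff mi i : measurable [set y : borel H2 | `|<[q i, y]>| < kappa * t].
    exact: measurable_forall mi.
  rewrite -[X in measurable X]setTI.
  exact: (measurable_inner (q i) measurableT (measurable_itv_norm (kappa * t))).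
have mS : measurable S.
  by rewrite -[X in measurable X]setTI; exact: (@measurable_borel_snd R H2 H2 measurableT _ mB).
apply: (@le_trans _ _ (\int[gamma]_y (\1_S y)%:E)%E).
  apply: ge0_le_integral_any => y; first by rewrite lee_fin indicE.
  rewrite lee_fin !indicE; have [|_] := boolP (upd om j y \in _); last by rewrite ler0n.
  rewrite inE => -[c _ /= cy]; rewrite mem_set// => i.
  have sj : sample (upd om j y) j = y.2 by rewrite /sample tnth_mktuple eqxx.
  have si l : l != j -> sample (upd om j y) l = sample om l.
    by move=> lj; rewrite /sample tnth_mktuple (negbTE lj).
  have -> : <[q i, y.2]> = <[q i, sample (upd om j y) j -
      \sum_(i | i != j) ratr (c i) *: sample (upd om j y) i]>.
    rewrite innerBr sj inner_sumr big1 ?subr0// => l lj.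
    by rewrite innerZr si// qv ?mulr0//; apply/mapP; exists l; rewrite ?mem_enum.
  apply: le_lt_trans (cauchy_schwarz _ _) _.
  apply: (@le_lt_trans _ _ (kappa * `|sample (upd om j y) j -
      \sum_(i | i != j) ratr (c i) *: sample (upd om j y) i|)); first by rewrite ler_wpM2r.
  by rewrite ltr_pM2l.
rewrite integral_indic// setIT.
have [_ gS] := hgamma mB.
suff : (mu [set y : borel H2 | forall i, `|<[q i, y]>| < kappa * t]%R <=
  ((2 * (kappa * t)) ^+ 3)%:E)%E by rewrite -gS.
apply: (gaussian_small_ball _ gmu); first by rewrite mulr_ge0// ltW.
move=> c; rewrite /= (adjointP o1 _ _ hsA) inner_normE (adjoint_sum o1 hsA).
exact: (norm_orthonormal_sum c (index_enum_uniq _) oq).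
Qed.

(* A dyadic upper bound for the squared inverse of the distances to the spans. *)
Definition inv_dist (om : r.-tuple T) : \bar R :=
  (1 + \sum_(0 <= k <oo) (4 ^+ k.+1)%:E * \sum_(j < r) (\1_(near_span j (2^-1 ^+ k)) om)%:E)%E.

Let term0 k om : (0 <= (4 ^+ k.+1)%:E * \sum_(j < r) (\1_(near_span j (2^-1 ^+ k)) om)%:E :> \bar R)%E.
Proof.
rewrite mule_ge0 ?lee_fin ?exprn_ge0//.
by apply: sume_ge0 => j _; rewrite lee_fin indicE.
Qed.

Lemma inv_dist_ge1 om : (1 <= inv_dist om)%E.
Proof. by rewrite leeDl// nneseries_ge0. Qed.

Lemma inv_dist_witness om : (inv_dist om < +oo)%E -> exists t, [/\ 0 < t,
  ((t ^- 2)%:E <= inv_dist om)%E & forall (c : 'cV[R]_r) i, t * `|c i 0| <= `|qm_op (sample om) c|].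
Proof.
move=> fin; pose far k := [forall j, om \notin near_span j (2^-1 ^+ k)].
have near_ge k : ~~ far k -> (1 <= \sum_(j < r) (\1_(near_span j (2^-1 ^+ k)) om)%:E :> \bar R)%E.
  rewrite negb_forall => /existsP[j]; rewrite negbK => jn.
  by rewrite (bigD1 j)//= indicE jn leeDl//; apply: sume_ge0 => i _; rewrite lee_fin indicE.
(* Otherwise every term of the series would be at least 1 and [inv_dist] infinite. *)
have far_ex : exists k, far k.
  apply: contrapT => /forallNP nfar.
  suff ge n : (n%:R%:E <= inv_dist om)%E.
    move: fin ge; case: (inv_dist om) (inv_dist_ge1 om) => [x|//|//] x1 _ ge.
    have := ge (Num.bound x); rewrite lee_fin leNgt => /negP; apply.
    by have := archi_boundP (le_trans ler01 x1).
  apply: le_trans (leeDr _ _); last by rewrite lee_fin.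
  apply: le_trans (nneseries_lim_ge n _); last by move=> k _ _; exact: term0.
  rewrite (_ : n%:R%:E = \sum_(0 <= k < n) 1%:E)%E; last first.
    by rewrite sumEFin big_const_nat subn0 iter_addr_0.
  apply: lee_sum => k _; rewrite -[leLHS]mule1; apply: lee_pmul => //.
    by rewrite lee_fin exprn_ege1// ler1n.
  by apply: near_ge; apply/negP; exact: nfar.
(* The witness is the largest dyadic scale at which all samples are far. If [k > 0], the scale
   before it fails and contributes [4 ^+ k] = t^-2, which explains the shifted exponent in
   [inv_dist]; if [k = 0], then t = 1 and the summand 1 suffices. *)
have [k fk kmin] := ex_minnP far_ex.
exists (2^-1 ^+ k); split; first by rewrite exprn_gt0.
  case: k fk kmin => [|k] fk kmin; first by rewrite expr0 expr1n invr1 inv_dist_ge1.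
  have nk : ~~ far k by apply/negP => /kmin; rewrite ltnn.
  apply: le_trans (leeDr _ _); last by rewrite lee_fin.
  apply: le_trans (nneseries_lim_ge k.+1 _); last by move=> l _ _; exact: term0.
  rewrite big_nat_recr//=; apply: le_trans (leeDr _ _); last exact: sume_ge0.
  have -> : ((2^-1 ^+ k.+1) ^- 2 : R) = 4 ^+ k.+1.
    by rewrite -exprM mulnC exprM !exprVn invrK -natrX.
  by rewrite -[leLHS]mule1; apply: lee_pmul; rewrite ?near_ge// lee_fin exprn_ge0.
apply: near_span_lower => j; have /forallP/(_ j) := fk.
by rewrite notin_setE.
Qed.

Let mterm k : measurable_fun setT (fun om =>
  ((4 ^+ k.+1)%:E * \sum_(j < r) (\1_(near_span j (2^-1 ^+ k)) om)%:E : \bar R)%E).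
Proof.
apply: emeasurable_funM => //; apply: emeasurable_sum => j; apply/measurable_EFinP.
by apply: measurable_indic; exact: measurable_near_span.
Qed.

Let mseries : measurable_fun setT (fun om =>
  \sum_(0 <= k <oo) ((4 ^+ k.+1)%:E * \sum_(j < r) (\1_(near_span j (2^-1 ^+ k)) om)%:E : \bar R))%E.
Proof. by apply: ge0_emeasurable_sum => // k om _ _; exact: term0. Qed.

Lemma measurable_inv_dist : measurable_fun setT inv_dist.
Proof. exact: emeasurable_funD. Qed.

(** The k-th term is at most 4^(k+1) r (2 kappa 2^-k)^3 = 64 r kappa^3 / 2^(k+1), a geometric series
    with sum 64 r kappa^3. *)
Lemma integral_inv_dist :
  (\int[power_prob gamma r]_om inv_dist om <= (1 + r%:R * 64 * kappa ^+ 3)%R%:E)%E.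
Proof.
have mind j t : measurable_fun setT (fun om => (\1_(near_span j t) om)%:E : \bar R).
  by apply/measurable_EFinP; apply: measurable_indic; exact: measurable_near_span.
rewrite ge0_integralD//; last by move=> om _; apply: nneseries_ge0.
rewrite EFinD; apply: leeD; first by rewrite integral_cst_probability.
rewrite integral_nneseries//.
apply: (@le_trans _ _ (\sum_(0 <= k <oo) ((r%:R * 64 * kappa ^+ 3) / (2 ^ (k + 1))%:R)%:E)%E); last first.
  have := @cvg_geometric_eseries_half R (r%:R * 64 * kappa ^+ 3) 0.
  by rewrite expr0 divr1 => /cvg_lim h; rewrite -[leRHS]h.
apply: lee_nneseries => [k _ _|k _]; first by apply: integral_ge0 => om _; exact: term0.
rewrite ge0_integralZl//; last 2 first.
- by apply: emeasurable_sum.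
- by move=> om _; apply: sume_ge0 => j _; rewrite lee_fin indicE.
rewrite ge0_integral_sum//.
apply: (@le_trans _ _ ((4 ^+ k.+1)%:E * \sum_(j < r) ((2 * (kappa * 2^-1 ^+ k)) ^+ 3)%:E)%E).
  rewrite lee_wpmul2l ?lee_fin ?exprn_ge0//; apply: lee_sum => j _.
  by apply: near_span_prob; rewrite exprn_ge0.
rewrite sumEFin sumr_const card_ord -EFinM lee_fin.
rewrite natrX addn1 exprVn -[_ *+ r]mulr_natl !exprMn.
have -> : 4 ^+ k.+1 = (2 ^+ k.+1) ^+ 2 :> R.
  by rewrite -exprM mulnC exprM expr2; congr (_ ^+ _); ring.
rewrite (exprS 2 k) le_eqVlt; apply/orP; left; apply/eqP.
by field; rewrite expf_neq0.
Qed.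

End inverse_moment.

(** * The discretization error *)

Section best_error.
Context {R : realType} (H1 H2 : hilbertType R).
Hypotheses (o1 : orthonormal_basis (onb H1)) (o2 : orthonormal_basis (onb H2)).
Hypothesis sH2 : separable H2.
Variable A : {linear H1 -> H2}.
Hypothesis hsA : hilbert_schmidt A.
Local Notation As := (adjoint A).
Variables (r : nat) (M kappa : R).
Hypotheses (rA : rank_ge A (r + 2)) (hM : hs2 A = M%:E).
Hypothesis kappa0 : 0 < kappa.
Hypothesis frame : forall k vs, (size vs + k <= r + 2)%N -> exists q : 'I_k -> H2,
    [/\ orthonormal_family (As \o q), (forall i, `|q i| <= kappa) &
        forall i v, v \in vs -> inner (q i) v = 0].
Variables (m n : nat) (Z : quasimatrix H2 m) (W : quasimatrix H1 n).
Hypothesis oW : orthonormal_family W.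
Variables (mu mun : probability (borel H2) R).
Hypotheses (gmu : gaussian mu (A \o As)) (gmun : gaussian mun (A \o qm_outer W \o As)).
Local Notation T := (borel (H2 * H2)%type).

Let c0 : R := Num.sqrt M + 1.

(** The three summands come from the truncation, the coupling cost of the [r] columns and the
    inverse moment. *)
Definition error_constant : R :=
  2 + 4 * c0 * (r%:R * 8) + 4 * c0 * r.+1%:R * (1 + r%:R * 64 * kappa ^+ 3).

Let sqM0 : 0 <= Num.sqrt M. Proof. exact: sqrtr_ge0. Qed.

Lemma error_constant_gt0 : 0 < error_constant.
Proof.
rewrite /error_constant -addrA ltr_wpDr// /c0.
by rewrite addr_ge0 ?mulr_ge0 ?addr_ge0 ?mulr_ge0 ?exprn_ge0 ?ler0n// ltW.
Qed.

Lemma best_rsvd_error_le delta D : 0 <= delta -> delta < D ->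
  (discr_error A Z W <= delta%:E)%E ->
  (best_rsvd_error A Z W r mun mu <= (error_constant * D)%:E)%E.
Proof.
move=> d0 dD hd; have D0 : 0 < D by exact: le_lt_trans dD.
have [gamma hg cost] := exists_coupling o1 o2 sH2 hsA oW gmu gmun hM d0 dD hd.
apply: ereal_inf_le; exists (expected_rsvd_error A Z W r gamma); first by exists gamma.
pose dist (x : T) : \bar R := (`|(x : H2 * H2).2 - qm_outer Z (x : H2 * H2).1| ^+ 2)%:E.
(* The coefficient of [inv_dist] has to be positive for the bound to be infinite wherever [inv_dist]
   is; the 1 in [c0] and [r.+1] in place of [r] ensure this. The weights 1/D and D balance a
   coupling cost of order D^2 against an inverse moment of order 1. *)
pose bound (om : r.-tuple T) : \bar R := ((2 * delta)%R%:E +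
  ((4 * c0 / D)%R%:E * \sum_j dist (tnth om j) +
   (4 * c0 * r.+1%:R * D)%R%:E * inv_dist om))%E.
have c00 : 0 < c0 by rewrite ltr_wpDl.
have c1 : 0 <= 4 * c0 / D by rewrite divr_ge0 ?mulr_ge0 ?(ltW c00) ?(ltW D0).
have c2 : 0 < 4 * c0 * r.+1%:R * D by rewrite !mulr_gt0.
have dist0 x : (0 <= dist x)%E by rewrite lee_fin sqr_ge0.
have sum0 om : (0 <= \sum_(j < r) dist (tnth om j))%E by exact: sume_ge0.
have inv0 om : (0 <= inv_dist om :> \bar R)%E by apply: le_trans (inv_dist_ge1 om); rewrite lee_fin.
have pointwise om : (hs_norm (fun x => rsvd A (fun j => (tnth om j : H2 * H2).2) x -
    rsvd_discr A Z W (fun j => (tnth om j : H2 * H2).1) x)%R <= bound om)%E.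
  have [fin|inf] := ltP (inv_dist om) +oo%E; last first.
    rewrite /bound; have -> : (inv_dist om = +oo)%E by apply/eqP; rewrite -leye_eq.
    rewrite gt0_muley ?lte_fin// [X in (_ + X)%E]addey ?addey ?leey//.
    by rewrite gt_eqF// (lt_le_trans (ltNyr 0))// mule_ge0.
  have [t [t0 tinv tlow]] := inv_dist_witness fin.
  apply: le_trans (rsvd_error_bound o1 o2 hsA oW _ t0 d0 hd hM tlow) _.
  move: tinv fin; rewrite /bound; case: (inv_dist om) => [g||]// tinv _.
  rewrite /dist sumEFin -!EFinM -!EFinD lee_fin lerD2l.
  rewrite lee_fin in tinv.
  set a := fun j => `|sample om j - qm_outer Z (tnth om j : H2 * H2).1|.
  have key : \sum_(j < r) a j / t <= 2^-1 * (\sum_j a j ^+ 2 / D + r.+1%:R * D * g).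
    apply: (@le_trans _ _ (\sum_(j < r) (2^-1 * (a j ^+ 2 / D + D * t ^- 2)))).
      apply: ler_sum => j _; have : 0 <= D^-1 * (a j - D / t) ^+ 2.
        by rewrite mulr_ge0 ?sqr_ge0// invr_ge0 ltW.
      have -> : D^-1 * (a j - D / t) ^+ 2 = a j ^+ 2 / D + D * t ^- 2 - 2 * (a j / t).
        by field; rewrite !gt_eqF.
      by lra.
    rewrite -mulr_sumr ler_wpM2l// big_split/= lerD2l sumr_const card_ord.
    rewrite -[_ *+ r]mulr_natl -mulrA; apply: ler_pM => //.
    - by rewrite mulr_ge0 ?invr_ge0 ?sqr_ge0 ?(ltW D0).
    - by rewrite ler_nat.
    - by rewrite ler_wpM2l ?(ltW D0).
  rewrite mulr_suml.
  have sc : Num.sqrt M <= c0 by rewrite lerDl.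
  have K0 : 0 <= \sum_(j < r) a j / t by apply: sumr_ge0 => j _; rewrite divr_ge0 ?(ltW t0)// /a normr_ge0.
  apply: (@le_trans _ _ (8 * c0 * \sum_(j < r) a j / t)).
    by rewrite ler_wpM2r// ler_wpM2l.
  apply: (@le_trans _ _ (8 * c0 * (2^-1 * (\sum_j a j ^+ 2 / D + r.+1%:R * D * g)))).
    by rewrite ler_wpM2l// mulr_ge0// ltW.
  by rewrite -mulr_suml /a /sample; lra.
have mdist : measurable_fun [set: T] dist.
  apply/measurable_EFinP; apply: (weakly_measurable_norm o2) => h.
  have m1 := @measurable_borel_fst R H2 H2; have m2 := @measurable_borel_snd R H2 H2.
  under eq_fun do rewrite innerBr -qm_outer_sym.
  apply: measurable_funB; first exact: (measurableT_comp (measurable_inner h) m2).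
  exact: (measurableT_comp (measurable_inner (qm_outer Z h)) m1).
have mdistj j : measurable_fun setT (fun om : r.-tuple T => dist (tnth om j)).
  exact: (measurableT_comp mdist (@measurable_tnth _ _ _ j)).
have msum : measurable_fun setT (fun om : r.-tuple T => \sum_j dist (tnth om j))%E.
  exact: emeasurable_sum.
have minv := measurable_inv_dist o2 (r := r).
have intdist : (\int[power_prob gamma r]_om \sum_j dist (tnth om j) <=
    (r%:R * (8 * D ^+ 2))%:E)%E.
  rewrite ge0_integral_sum//.
  apply: (@le_trans _ _ (\sum_(j < r) (8 * D ^+ 2)%:E)%E).
    apply: lee_sum => j _.
    apply: (@integral_power_prob_le _ _ _ gamma _ (fun om => dist (tnth om j)) j) => // om.
    by under eq_integral do rewrite tnth_mktuple eqxx.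
  by rewrite sumEFin sumr_const card_ord -[_ *+ r]mulr_natl.
have intinv := integral_inv_dist o1 o2 hsA gmu hg kappa0 frame.
apply: (@le_trans _ _ (\int[power_prob gamma r]_om bound om)%E).
  by apply: ge0_le_integral_any => // om; exact: sqrte_ge0.
have b2 om : (0 <= (4 * c0 / D)%R%:E * \sum_(j < r) dist (tnth om j))%E by apply: mule_ge0.
have b3 om : (0 <= (4 * c0 * r.+1%:R * D)%R%:E * inv_dist om)%E by apply: mule_ge0; rewrite ?lee_fin ?(ltW c2).
have m2 : measurable_fun setT (fun om : r.-tuple T => ((4 * c0 / D)%R%:E * \sum_(j < r) dist (tnth om j))%E).
  exact: emeasurable_funM.
have m3 : measurable_fun setT (fun om : r.-tuple T => ((4 * c0 * r.+1%:R * D)%R%:E * inv_dist om)%E).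
  exact: emeasurable_funM.
rewrite /bound ge0_integralD//; last 3 first.
- by move=> om _; rewrite lee_fin mulr_ge0.
- by move=> om _; rewrite adde_ge0.
- exact: emeasurable_funD.
rewrite ge0_integralD// !ge0_integralZl//; last by rewrite lee_fin ltW.
rewrite integral_cst_probability.
apply: (@le_trans _ _ ((2 * D)%:E + ((4 * c0 / D)%:E * (r%:R * (8 * D ^+ 2))%:E +
    (4 * c0 * r.+1%:R * D)%:E * (1 + r%:R * 64 * kappa ^+ 3)%:E))%E).
  apply: leeD; first by rewrite lee_fin ler_wpM2l// ltW.
  by apply: leeD; apply: lee_wpmul2l; rewrite ?lee_fin ?(ltW c2).
rewrite -!EFinM -!EFinD lee_fin le_eqVlt; apply/orP; left; apply/eqP.
by rewrite /error_constant; field; rewrite gt_eqF.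
Qed.

End best_error.

Theorem theorem6 (R : realType) (H1 H2 : hilbertType R) (k p : nat)
    (A : {linear H1 -> H2})
    (W : forall n : nat, quasimatrix H1 n)
    (Z : forall m : nat, quasimatrix H2 m)
    (mu : probability (borel H2) R) (mu_ : nat -> probability (borel H2) R) :
  separable H1 -> infinite_dim H1 ->
  separable H2 -> infinite_dim H2 ->
  (1 <= k)%N ->
  hilbert_schmidt A ->
  rank_ge A (k + p + 2) ->
  (forall n, orthonormal_family (W n)) ->
  (forall m, orthonormal_family (Z m)) ->
  discr_error A (Z mn.1) (W mn.2) @[mn --> filter_prod \oo \oo] --> 0%E ->
  gaussian mu (A \o adjoint A) ->
  (forall n, gaussian (mu_ n) (A \o qm_outer (W n) \o adjoint A)) ->
  (exists C : R, forall m n : nat,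
     (best_rsvd_error A (Z m) (W n) (k + p) (mu_ n) mu
        <= C%:E * discr_error A (Z m) (W n))%E) /\
  best_rsvd_error A (Z mn.1) (W mn.2) (k + p) (mu_ mn.2) mu
    @[mn --> filter_prod \oo \oo] --> 0%E.
Proof.
move=> sH1 iH1 sH2 iH2 _ hsA rA oW _ lim0 gmu gmun.
have o1 := onbP sH1 iH1; have o2 := onbP sH2 iH2.
have [kappa kappa0 frame] := orthogonal_frame o1 hsA rA.
have [M hM] : exists M, hs2 A = M%:E.
  have := hs2_ge0 A; have := hsA.2; rewrite hs_normE.
  by case: (hs2 A) => [M||]//; exists M.
set C := error_constant (k + p) M kappa.
have C0 : 0 < C by exact: error_constant_gt0.
have bound m n : (best_rsvd_error A (Z m) (W n) (k + p) (mu_ n) mu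
    <= C%:E * discr_error A (Z m) (W n))%E.
  have : (0 <= discr_error A (Z m) (W n))%E by exact: sqrte_ge0.
  case E : (discr_error A (Z m) (W n)) => [delta||]// d0; last first.
    by rewrite gt0_muley ?lte_fin// leey.
  rewrite -EFinM; apply/lee_addgt0Pr => e e0.
  have d0' : 0 <= delta by rewrite -lee_fin.
  have hE : (discr_error A (Z m) (W n) <= delta%:E)%E by rewrite E.
  (* With this [D] the bound [C * D] exceeds [C * delta] by exactly [e]. *)
  have De : delta < delta + e / C by rewrite ltrDl divr_gt0.
  have h := best_rsvd_error_le o1 o2 sH2 hsA hM kappa0 frame (oW n) gmu (gmun n) d0' De hE.
  apply: (le_trans h).
  by rewrite -EFinD lee_fin -/C mulrDr mulrCA mulfV ?mulr1// gt_eqF.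
split; first by exists C.
have limC : (C%:E * discr_error A (Z mn.1) (W mn.2))%E @[mn --> filter_prod \oo \oo] --> 0%E.
  by rewrite -[X in _ --> X](mule0 C%:E); exact: cvgeZl.
apply: squeeze_cvge (cvg_cst 0%E) limC; apply: nearW => mn; rewrite bound andbT.
apply/ereal_infP => _ [g _ <-].
by apply: integral_ge0 => om _; exact: sqrte_ge0.
Qed.
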